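(* Let $\delta>0$ be given. With the sets of pairs $\mathcal{P},\mathcal{A}_{\rm H},\mathcal{A}_{\rm N},\mathcal{A}_{\rm J},\mathcal{O}_{\rm F},\mathcal{O}_{\rm P}$, the sets of interconnections $\mathcal{G}_{\geq\delta},\mathcal{G}_{>0},\mathcal{G}_{\geq 0}$, and the notion of synchronizability defined in the context, the following hold. (a) Every $(C,A)\in\mathcal{A}_{\rm H}$ is synchronizable with respect to $\mathcal{G}_{\geq 0}$. (b) Every $(C,A)\in\mathcal{A}_{\rm N}\cap\mathcal{O}_{\rm P}$ is synchronizable with respect to $\mathcal{G}_{>0}$. (c) Every $(C,A)\in\mathcal{A}_{\rm J}\cap\mathcal{O}_{\rm F}$ is synchronizable with respect to $\mathcal{G}_{>0}$. (d) Every $(C,A)\in\mathcal{O}_{\rm P}$ is synchronizable with respect to $\mathcal{G}_{\geq\delta}$. (e) Not all $(C,A)\in\mathcal{A}_{\rm N}\cap\mathcal{O}_{\rm F}$ are synchronizable with respect to $\mathcal{G}_{\geq 0}$. (f) Not all $(C,A)\in\mathcal{A}_{\rm J}\cap\mathcal{O}_{\rm P}$ are synchronizable with respect to $\mathcal{G}_{>0}$. (g) Not all $(C,A)\in\mathcal{O}_{\rm F}$ are synchronizable with respect to $\mathcal{G}_{>0}$. (h) Not all $(C,A)\in\mathcal{P}$ are synchronizable with respect to $\mathcal{G}_{\geq\delta}$.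
   Context: Interconnections. A matrix $\Gamma=[\gamma_{ij}]\in\mathbb{R}^{p\times p}$ (any size $p$) is an interconnection if $\gamma_{ij}\geq 0$ for $i\neq j$ and $\gamma_{ii}=-\sum_{j\neq i}\gamma_{ij}$. Its graph is the directed graph with nodes $n_1,\ldots,n_p$ in which $(n_i,n_j)$ is an edge iff $\gamma_{ij}>0$. A path from $n_1$ to $n_\ell$ is a sequence of nodes in which each consecutive ordered pair is an edge. A directed graph is connected if it has a node to which there exists a path from every other node. $\Gamma$ is connected if its graph is connected. For connected $\Gamma$, the eigenvalue $0$ is simple and all other eigenvalues have strictly negative real parts; ${\rm Re}(\lambda_2(\Gamma))$ denotes the real part of a nonzero eigenvalue of $\Gamma$ closest to the imaginary axis. Sets of interconnections (each containing matrices of all sizes $p$): $\mathcal{G}_{\geq 0}$ is the set of all interconnections; $\mathcal{G}_{>0}$ is the set of all connected interconnections; $\mathcal{G}_{\geq\delta}$ is the set of all connected interconnections with $|{\rm Re}(\lambda_2(\Gamma))|\geq\delta$. Sets of pairs. $\mathcal{P}$ is the set of all pairs $(C,A)$ of real matrices with $A\in\mathbb{R}^{n\times n}$ and $C\in\mathbb{R}^{m\times n}$ for some $m,n$. Subsets of $\mathcal{P}$: $\mathcal{A}_{\rm H}$: pairs with $A$ Hurwitz (all eigenvalues have strictly negative real parts); $\mathcal{A}_{\rm N}$: pairs with $A$ neutrally stable (no eigenvalue with positive real part, and every Jordan block corresponding to an eigenvalue on the imaginary axis has size one); $\mathcal{A}_{\rm J}$: pairs with $A$ having no eigenvalue with positive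 real part; $\mathcal{O}_{\rm F}$: pairs with $C$ of full column rank; $\mathcal{O}_{\rm P}$: detectable pairs, where $(C,A)$ is detectable if for every $x\in\mathbb{R}^n$, $Ce^{At}x=0$ for all $t\geq 0$ implies $\lim_{t\to\infty}e^{At}x=0$. Synchronization. Maps $\xi_i:\mathbb{R}_{\geq 0}\to\mathbb{R}^n$, $i=1,\ldots,p$, synchronize to $\bar\xi:\mathbb{R}_{\geq 0}\to\mathbb{R}^n$ if $|\xi_i(t)-\bar\xi(t)|\to 0$ as $t\to\infty$ for all $i$; they synchronize if they synchronize to some $\bar\xi$. Synchronizability. Given $A\in\mathbb{R}^{n\times n}$, $C\in\mathbb{R}^{m\times n}$ and a set $\mathcal{S}$ of interconnections, $(C,A)$ is synchronizable with respect to $\mathcal{S}$ if there exists $L\in\mathbb{R}^{n\times m}$ such that for each $\Gamma\in\mathcal{S}$ (with $\Gamma\in\mathbb{R}^{p\times p}$) the solutions $x_i(\cdot)$, $i=1,\ldots,p$, of the array $$\dot{x}_i=Ax_i+u_i,\quad y_i=Cx_i,\quad z_i=\sum_{j\neq i}\gamma_{ij}(y_j-y_i),\quad u_i=Lz_i,$$ with $x_i\in\mathbb{R}^n$, synchronize for all initial conditions. *)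

(* Defs.v *)
From mathcomp Require Import all_boot all_order all_algebra.
From mathcomp Require Import all_classical all_reals all_analysis.
From mathcomp Require Import complex.

Set Implicit Arguments.
Unset Strict Implicit.
Unset Printing Implicit Defensive.

Import Order.TTheory GRing.Theory Num.Theory.
Import numFieldNormedType.Exports.

Local Open Scope classical_set_scope.
Local Open Scope ring_scope.
Local Open Scope complex_scope.

(* Complex eigenvalues of a real matrix; [eigenvalue] refers to row vectors,
   which gives the same spectrum as column vectors. *)
Definition ceigenvalue (R : realType) (n : nat) (A : 'M[R]_n) (l : R[i]) : Prop :=
  eigenvalue (map_mx (real_complex R) A) l.

Definition is_interconnection (R : realType) (p : nat) (G : 'M[R]_p) : Prop :=
  (forall i j, i != j -> 0 <= G i j) /\
  (forall i, G i i = - \sum_(j | j != i) G i j).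

Definition graph_edge (R : realType) (p : nat) (G : 'M[R]_p) : rel 'I_p :=
  fun i j => 0 < G i j.

Definition connected_digraph (p : nat) (e : rel 'I_p) : Prop :=
  exists r, forall i, i != r -> connect e i r.

(* [l] is a nonzero eigenvalue of [G] closest to the imaginary axis: an
   admissible choice of lambda_2.  It has no instance when [p = 1]. *)
Definition is_lambda2 (R : realType) (p : nat) (G : 'M[R]_p) (l : R[i]) : Prop :=
  [/\ ceigenvalue G l, l != 0 &
      forall l', ceigenvalue G l' -> l' != 0 ->
        `|complex.Re l| <= `|complex.Re l'|].

(* A set of interconnections contains matrices of all sizes [p]. *)
Definition mxfamily (R : realType) : Type := forall p : nat, set 'M[R]_p.

Definition G_ge0 (R : realType) : mxfamily R :=
  fun p => [set G | is_interconnection G].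

Definition G_gt0 (R : realType) : mxfamily R :=
  fun p => [set G | is_interconnection G /\ connected_digraph (graph_edge G)].

Definition G_ge (R : realType) (delta : R) : mxfamily R :=
  fun p => [set G | [/\ is_interconnection G,
                        connected_digraph (graph_edge G) &
                        forall l, is_lambda2 G l -> delta <= `|complex.Re l|]].

(* State and output dimensions are [sdim.+1] and [odim.+1], hence positive. *)
Record mxpair (R : realType) : Type := MxPair {
  sdim : nat;
  odim : nat;
  outmx : 'M[R]_(odim.+1, sdim.+1);
  dynmx : 'M[R]_sdim.+1 }.

Definition P_all (R : realType) : set (mxpair R) := setT.

Definition hurwitz (R : realType) (n : nat) (A : 'M[R]_n) : Prop :=
  forall l, ceigenvalue A l -> complex.Re l < 0.

Definition no_unstable_eigenvalue (R : realType) (n : nat) (A : 'M[R]_n) : Prop :=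
  forall l, ceigenvalue A l -> complex.Re l <= 0.

Definition jordan_block (K : fieldType) (s : nat) (l : K) : 'M[K]_s :=
  \matrix_(i, j) (l *+ (j == i) + (j == i.+1 :> nat)%:R).

(* [A] is similar to the block-diagonal matrix with Jordan blocks of size [s i]
   and eigenvalue [l i].  The change of basis is a pair of mutually inverse
   rectangular matrices, so that the sizes [n] and [\sum_i s i] (which are then
   equal) need not be convertible. *)
Definition jordan_form (K : fieldType) (n : nat) (A : 'M[K]_n)
    (k : nat) (s : 'I_k -> nat) (l : 'I_k -> K) : Prop :=
  (forall i, (0 < s i)%N) /\
  exists (T : 'M[K]_(n, \sum_i s i)) (T' : 'M[K]_(\sum_i s i, n)),
    [/\ T *m T' = 1%:M, T' *m T = 1%:M &
        A = T *m (\mxdiag_i jordan_block (s i) (l i)) *m T'].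

(* The Jordan form exists over the complex numbers and is unique up to the order
   of its blocks, so quantifying existentially over it loses nothing. *)
Definition neutrally_stable (R : realType) (n : nat) (A : 'M[R]_n) : Prop :=
  no_unstable_eigenvalue A /\
  exists (k : nat) (s : 'I_k -> nat) (l : 'I_k -> R[i]),
    jordan_form (map_mx (real_complex R) A) s l /\
    forall i, complex.Re (l i) = 0 -> s i = 1%N.

Definition expmx (R : realType) (n : nat) (A : 'M[R]_n) : 'M[R]_n :=
  lim (series (fun k : nat => (k`!%:R)^-1 *: A ^+ k) @ \oo).

Definition detectable (R : realType) (m n : nat)
    (C : 'M[R]_(m, n)) (A : 'M[R]_n) : Prop :=
  forall x : 'cV[R]_n,
    (forall t : R, 0 <= t -> C *m expmx (t *: A) *m x = 0) ->
    expmx (t *: A) *m x @[t --> +oo] --> (0 : 'cV[R]_n).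

Definition A_H (R : realType) : set (mxpair R) := [set CA | hurwitz (dynmx CA)].

Definition A_N (R : realType) : set (mxpair R) :=
  [set CA | neutrally_stable (dynmx CA)].

Definition A_J (R : realType) : set (mxpair R) :=
  [set CA | no_unstable_eigenvalue (dynmx CA)].

Definition O_F (R : realType) : set (mxpair R) :=
  [set CA | row_full (outmx CA)]. (* rank = number of columns *)

Definition O_P (R : realType) : set (mxpair R) :=
  [set CA | detectable (outmx CA) (dynmx CA)].

(* Trajectories are functions on [R] of which only the values at nonnegative
   times matter; [`| |] is the max norm. *)
Definition synchronize_to (R : realType) (n p : nat)
    (xi : 'I_p -> R -> 'cV[R]_n.+1) (xibar : R -> 'cV[R]_n.+1) : Prop :=
  forall i, `|xi i t - xibar t| @[t --> +oo] --> (0 : R).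

Definition synchronize (R : realType) (n p : nat)
    (xi : 'I_p -> R -> 'cV[R]_n.+1) : Prop :=
  exists xibar, synchronize_to xi xibar.

(* Solutions on [0, +oo[: continuous there, differentiable with the prescribed
   derivative on ]0, +oo[. *)
Definition array_solution (R : realType) (n m p : nat)
    (A : 'M[R]_n.+1) (C : 'M[R]_(m.+1, n.+1)) (L : 'M[R]_(n.+1, m.+1))
    (G : 'M[R]_p) (x : 'I_p -> R -> 'cV[R]_n.+1) : Prop :=
  let y i t := C *m x i t in
  let z i t := \sum_(j | j != i) G i j *: (y j t - y i t) in
  let u i t := L *m z i t in
  forall i,
    {within `[0, +oo[%classic, continuous (x i)} /\
    (forall t : R, 0 < t -> is_derive t 1 (x i) (A *m x i t + u i t)).

Definition synchronizable (R : realType) (S : mxfamily R) : set (mxpair R) :=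
  [set CA | exists L : 'M[R]_((sdim CA).+1, (odim CA).+1),
     forall (p : nat) (G : 'M[R]_p), S p G ->
     forall (x0 : 'I_p -> 'cV[R]_(sdim CA).+1)
            (x : 'I_p -> R -> 'cV[R]_(sdim CA).+1),
       (forall i, x i 0 = x0 i) ->
       array_solution (dynmx CA) (outmx CA) L G x ->
       synchronize x].

Arguments G_ge0 R p _ : clear implicits.
Arguments G_gt0 R p _ : clear implicits.
Arguments G_ge {R} delta p _.
Arguments P_all R _ : clear implicits.
Arguments A_H R _ : clear implicits.
Arguments A_N R _ : clear implicits.
Arguments A_J R _ : clear implicits.
Arguments O_F R _ : clear implicits.
Arguments O_P R _ : clear implicits.

(* Main.v *)
(* Since the rows of [G] sum to zero, the combination [xi_w = \sum_i w_i x_i] of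
   the states weighted by a row [w] satisfies
     xi_w' = A xi_w + L C xi_(w G),
   so that an eigenrow of [G] for [l] sees the matrix [A + l L C].  A nonzero
   eigenvalue of an interconnection has negative real part (Gershgorin), and, if
   the graph is connected, the maximum principle makes the kernel of every power
   of [G] consist of the constant vectors; dually, the rows [e_i - e_j] lie in
   the image of every power of [G], and Cayley-Hamilton writes them through the
   nonzero modes only.  Hence the array synchronizes as soon as [A + l L C] is
   Hurwitz for every nonzero eigenvalue [l].

   If [L C = 1] this is a shift of the spectrum.  If [Q > 0] and
   [A^* Q + Q A <= 0], then [L = Q^-1 C^*] works for all [l] with [Re l < 0], by
   the eigenvector test for detectability.  In general one takes
   [L = k Q^-1 C^* W], where [A^* Q + Q A < C^* W C]: such [Q] and [W] come from
   a matrix [K] with [A + K C] Hurwitz by completing a square, and [K] and the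
   Lyapunov matrix of [A + K C] are obtained by induction on the dimension,
   splitting off a left eigenvector.  All these matrices are first found over
   the complex numbers, and then replaced by their real parts.

   The counterexamples are circulant networks of two or four nodes with an
   explicit solution.  For the double integrator, four nodes with states
   X, Y, -X, -Y realize couplings with nonzero imaginary part. *)

Require Import Defs.
From mathcomp Require Import all_boot all_order all_algebra.
From mathcomp Require Import all_classical all_reals all_analysis.
From mathcomp Require Import complex ring lra.

Set Implicit Arguments.
Unset Strict Implicit.
Unset Printing Implicit Defensive.

Import Order.TTheory GRing.Theory Num.Theory.
Import numFieldNormedType.Exports.

Local Open Scope classical_set_scope.
Local Open Scope ring_scope.
Local Open Scope sesquilinear_scope.

(** * Positive definite forms and Lyapunov matrices *)

(* Identities in the additive group of matrices, with products as atoms. *)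
Ltac mx_abel :=
  repeat (match goal with |- context [?A *m ?B] => let t := fresh "t" in
    set t := (A *m B); clearbody t end);
  apply/matrixP => ? ?; rewrite !mxE; ring.

Lemma adjM (C : numClosedFieldType) m n p (A : 'M[C]_(m, n)) (B : 'M[C]_(n, p)) :
  (A *m B)^t* = B^t* *m A^t*.
Proof. by rewrite trmx_mul map_mxM. Qed.

Lemma adjD (C : numClosedFieldType) m n (A B : 'M[C]_(m, n)) :
  (A + B)^t* = A^t* + B^t*.
Proof. by rewrite linearD /= map_mxD. Qed.

Lemma adjN (C : numClosedFieldType) m n (A : 'M[C]_(m, n)) :
  (- A)^t* = - A^t*.
Proof. by rewrite linearN /= map_mxN. Qed.

Lemma adjZ (C : numClosedFieldType) m n a (A : 'M[C]_(m, n)) :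
  (a *: A)^t* = a^* *: A^t*.
Proof. by rewrite linearZ /= map_mxZ. Qed.

Lemma adj1 (C : numClosedFieldType) n : (1%:M : 'M[C]_n)^t* = 1%:M.
Proof. by rewrite trmx1 map_mx1. Qed.

Lemma adj0 (C : numClosedFieldType) m n : (0 : 'M[C]_(m, n))^t* = 0.
Proof. by rewrite trmx0 map_mx0. Qed.

Definition adjE := (adjM, adjD, adjN, adjZ, adj1, adj0, @trmxCK).

Definition qform (C : numClosedFieldType) n (Q : 'M[C]_n) (v : 'cV_n) : C :=
  (v^t* *m Q *m v) 0 0.

Definition posdef (C : numClosedFieldType) n (Q : 'M[C]_n) :=
  Q^t* = Q /\ forall v, v != 0 -> 0 < qform Q v.

Definition possemidef (C : numClosedFieldType) n (Q : 'M[C]_n) :=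
  Q^t* = Q /\ forall v, 0 <= qform Q v.

(** The minus sign turns Lyapunov inequalities into positivity of a form, so that they add up with
    other positive forms. *)
Definition lyap (C : numClosedFieldType) n (A Q : 'M[C]_n) : 'M[C]_n :=
  - (A^t* *m Q + Q *m A).

Lemma lyap_adj (C : numClosedFieldType) n (A Q : 'M[C]_n) :
  Q^t* = Q -> (lyap A Q)^t* = lyap A Q.
Proof. by move=> hQ; rewrite /lyap !adjE hQ addrC. Qed.

Lemma qform_congr (C : numClosedFieldType) n r (P : 'M[C]_(r, n)) Q v :
  qform (P^t* *m Q *m P) v = qform Q (P *m v).
Proof. by rewrite /qform adjM !mulmxA. Qed.

Lemma qformD (C : numClosedFieldType) n (Q1 Q2 : 'M[C]_n) v :
  qform (Q1 + Q2) v = qform Q1 v + qform Q2 v.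
Proof. by rewrite /qform mulmxDr mulmxDl mxE. Qed.

Lemma qformZ (C : numClosedFieldType) n a (Q : 'M[C]_n) v :
  qform (a *: Q) v = a * qform Q v.
Proof. by rewrite /qform -scalemxAr -scalemxAl mxE. Qed.

Lemma qform1E (C : numClosedFieldType) n (v : 'cV[C]_n) :
  qform 1%:M v = \sum_i `|v i 0| ^+ 2.
Proof.
rewrite /qform mulmx1 mxE; apply: eq_bigr => i _.
by rewrite !mxE normCK mulrC.
Qed.

Lemma posdef_possemidef (C : numClosedFieldType) n (Q : 'M[C]_n) :
  posdef Q -> possemidef Q.
Proof.
case=> hQ pQ; split=> // v; have [->|v0] := eqVneq v 0; last exact/ltW/pQ.
by rewrite /qform mulmx0 mxE.
Qed.

Lemma posdef1 (C : numClosedFieldType) n : posdef (1%:M : 'M[C]_n).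
Proof.
split=> [|v v0]; first exact: adj1.
rewrite qform1E lt_def sumr_ge0 ?andbT; last by move=> i _; rewrite exprn_ge0.
apply: contra v0; rewrite psumr_eq0; last by move=> i _; rewrite exprn_ge0.
move=> /allP h; apply/eqP/matrixP => i j; rewrite ord1 mxE.
have := h i (mem_index_enum _); rewrite expf_eq0 normr_eq0 /=.
by move/eqP.
Qed.

Lemma possemidef_congr (C : numClosedFieldType) n r (P : 'M[C]_(r, n)) Q :
  possemidef Q -> possemidef (P^t* *m Q *m P).
Proof.
case=> hQ pQ; split=> [|v]; first by rewrite !adjE hQ mulmxA.
by rewrite qform_congr.
Qed.

Lemma posdef_congr (C : numClosedFieldType) n r (P : 'M[C]_(r, n)) P' Q :
  P' *m P = 1%:M -> posdef Q -> posdef (P^t* *m Q *m P).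
Proof.
move=> PP [hQ pQ]; split=> [|v v0]; first by rewrite !adjE hQ mulmxA.
rewrite qform_congr; apply: pQ; apply: contra v0 => /eqP h.
by rewrite -[v]mul1mx -PP -mulmxA h mulmx0.
Qed.

(** Both summands are nonnegative, and they vanish together only on the common kernel of [P] and
    [w]. The completed squares below are shown to be definite in this way. *)
Lemma posdefD_congr (C : numClosedFieldType) n r s (P : 'M[C]_(r, n))
    (w : 'M[C]_(s, n)) Q1 Q2 :
  posdef Q1 -> posdef Q2 ->
  (forall v : 'cV_n, P *m v = 0 -> w *m v = 0 -> v = 0) ->
  posdef (P^t* *m Q1 *m P + w^t* *m Q2 *m w).
Proof.
move=> pQ1 pQ2 inj; split=> [|v v0].
  by rewrite !adjE !mulmxA pQ1.1 pQ2.1.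
rewrite qformD !qform_congr.
have h1 := (posdef_possemidef pQ1).2 (P *m v).
have h2 := (posdef_possemidef pQ2).2 (w *m v).
have [e1|n1] := eqVneq (P *m v) 0; last by apply: ltr_wpDr => //; apply: pQ1.2.
have [e2|n2] := eqVneq (w *m v) 0; last by apply: ltr_wpDl => //; apply: pQ2.2.
by move: v0; rewrite (inj v) // eqxx.
Qed.

Lemma posdef_unitmx (C : numClosedFieldType) n (Q : 'M[C]_n) :
  posdef Q -> Q \in unitmx.
Proof.
case=> _ pQ; rewrite -unitmx_tr -row_free_unit -kermx_eq0.
apply/eqP/row_matrixP => i; rewrite row0.
apply/eqP; apply: contraT => u0.
have /pQ : (row i (kermx Q^T))^T != 0 by rewrite trmx_eq0.
have e : Q *m (row i (kermx Q^T))^T = 0.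
  by apply: trmx_inj; rewrite trmx_mul trmxK trmx0; apply/sub_kermxP; rewrite row_sub.
by rewrite /qform -mulmxA e mulmx0 mxE ltxx.
Qed.

(* [S] spans [ker w]; [P] and [w] are the coordinates along [ker w] and [s]. *)
Lemma split_hyperplane (F : fieldType) n (w : 'rV[F]_n) (s : 'cV[F]_n) :
  w *m s = 1%:M ->
  exists r (S : 'M[F]_(n, r)) (P : 'M[F]_(r, n)),
    (r < n)%N /\
    [/\ S *m P + s *m w = 1%:M, P *m S = 1%:M, P *m s = 0 & w *m S = 0].
Proof.
(* [E] is the projection onto the kernel of [w] along [s]; its rank factorization provides [S] and
   [P]. *)
move=> ws; pose E : 'M[F]_n := 1%:M - s *m w.
have wE : w *m E = 0 by rewrite mulmxBr mulmx1 mulmxA ws mul1mx subrr.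
have Es : E *m s = 0 by rewrite mulmxBl mul1mx -mulmxA ws mulmx1 subrr.
have EE : E *m E = E by rewrite {2}/E mulmxBr mulmx1 mulmxA Es mul0mx subr0.
have SP : col_base E *m row_base E = E by rewrite mulmx_base.
have rfR := row_base_free E; have cfC := col_base_full E.
exists (\rank E), (col_base E), (row_base E); split; last split.
- rewrite ltn_neqAle rank_leq_row andbT; apply/negP => rE.
  have : row_free E by [].
  move=> fE; have /(row_free_inj fE) w0 : w *m E = 0 *m E by rewrite wE mul0mx.
  move: ws; rewrite w0 mul0mx => /matrixP/(_ 0 0); rewrite !mxE /=.
  by move/eqP; rewrite eq_sym oner_eq0.
- by rewrite SP subrK.
- apply: (row_free_inj rfR); apply: (row_full_inj cfC).
  by rewrite mul1mx -mulmxA SP mulmxA SP EE.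
- by apply: (row_full_inj cfC); rewrite mulmxA SP Es mulmx0.
- by apply: (row_free_inj rfR); rewrite -mulmxA SP wE mul0mx.
Qed.

(** [eigenvalue] is about row vectors; a matrix and its transpose have the same characteristic
    polynomial. *)
Lemma eigenvalue_vector (F : fieldType) n (A : 'M[F]_n) a :
  reflect (exists2 v : 'cV_n, A *m v = a *: v & v != 0) (eigenvalue A a).
Proof.
have -> : eigenvalue A a = eigenvalue A^T a.
  rewrite !eigenvalue_root_char; congr (root _ _).
  rewrite /char_poly -[in RHS]det_tr; congr (\det _).
  by apply/matrixP => i j; rewrite !mxE eq_sym.
apply: (iffP eigenvalueP) => -[v vA v0].
  exists v^T; rewrite ?trmx_eq0 //.
  by rewrite -[A]trmxK -trmx_mul vA linearZ.
by exists v^T; rewrite ?trmx_eq0 // -trmx_mul vA linearZ.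
Qed.

Lemma eigenvalue_exists (C : closedFieldType) n (A : 'M[C]_n) :
  (0 < n)%N -> exists a, eigenvalue A a.
Proof.
move=> n0; have : size (char_poly A) != 1%N by rewrite size_char_poly eqSS -lt0n.
by move=> /closed_rootP[a ra]; exists a; rewrite eigenvalue_root_char.
Qed.

Lemma dual_vector (F : fieldType) n (w : 'rV[F]_n) :
  w != 0 -> exists s : 'cV_n, w *m s = 1%:M.
Proof.
move=> /rV0Pn[j wj]; exists ((w 0 j)^-1 *: delta_mx j 0).
rewrite -scalemxAr -colE; apply/matrixP => a b; rewrite !ord1 !mxE /=.
by rewrite mulVf.
Qed.

(** Insert [S *m P + s *m w] to the left of [A *m S]: the second term dies, since [w *m A *m S] is a
    multiple of [w *m S]. So [P *m A *m S] is the restriction of [A] to the hyperplane. *)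
Lemma invariant_hyperplane (F : fieldType) n r (A : 'M[F]_n) a
    (w : 'rV_n) (s : 'cV_n) (S : 'M[F]_(n, r)) (P : 'M[F]_(r, n)) :
  w *m A = a *: w -> S *m P + s *m w = 1%:M -> w *m S = 0 ->
  A *m S = S *m (P *m A *m S).
Proof.
move=> wA SP wS; rewrite -[LHS]mul1mx -SP mulmxDl !mulmxA.
by rewrite -(mulmxA s) wA -scalemxAr -!scalemxAl -(mulmxA s) wS mulmx0 scaler0 addr0.
Qed.

Lemma eigenvalue_restrict (F : fieldType) n r (A : 'M[F]_n) (A1 : 'M[F]_r)
    (S : 'M[F]_(n, r)) (P : 'M[F]_(r, n)) b :
  A *m S = S *m A1 -> P *m S = 1%:M ->
  forall y : 'cV_r, A1 *m y = b *: y -> A *m (S *m y) = b *: (S *m y) /\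
    (y != 0 -> S *m y != 0).
Proof.
move=> AS PS y Ay; split; first by rewrite mulmxA AS -mulmxA Ay scalemxAr.
by apply: contra => /eqP h; rewrite -[y]mul1mx -PS -mulmxA h mulmx0.
Qed.

(** [a + a^*] is twice the real part, expressed inside [C] itself. *)
Definition hurwitzC (C : numClosedFieldType) n (A : 'M[C]_n) :=
  forall a, eigenvalue A a -> a + a^* < 0.

(* Completing the square in the [P]-block leaves a positive multiple of
   [w^t* *m w], as [m] is large. *)
Lemma hurwitz_lyap (C : numClosedFieldType) n (A : 'M[C]_n) :
  hurwitzC A -> exists Q, posdef Q /\ posdef (lyap A Q).
Proof.
have [N] := ubnP n; elim: N n A => // N IH [|n] A; rewrite ltnS => nN hA.
  exists 0; split; split=> [|v]; try by apply/matrixP => -[].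
    by rewrite [v]flatmx0 eqxx.
  by rewrite [v]flatmx0 eqxx.
have [a eA] := @eigenvalue_exists _ _ A (ltn0Sn n).
have a0 := hA a eA; move: (eA) => /eigenvalueP[w wA w0].
have [s ws] := dual_vector w0.
have [r [S [P [rn [SP PS Ps wS]]]]] := split_hyperplane ws.
have AS := invariant_hyperplane wA SP wS.
set A1 := P *m A *m S in AS.
have hA1 : hurwitzC A1.
  move=> b /eigenvalue_vector[y Ay y0]; apply: hA.
  have [Ay1 Ay2] := eigenvalue_restrict AS PS Ay.
  by apply/eigenvalue_vector; exists (S *m y); auto.
have [Q1 [pQ1 pR1]] := IH r A1 (leq_trans rn nN) hA1.
set R1 := lyap A1 Q1 in pR1.
(* [b] is the off-diagonal block of [A]; the shift [g0], with [R1 *m g0 = Q1 *m b], absorbs the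
   cross terms when the square is completed. *)
pose b := P *m A *m s; pose g0 := invmx R1 *m (Q1 *m b).
have R1g0 : R1 *m g0 = Q1 *m b by rewrite mulKVmx // posdef_unitmx.
have hg0 : g0^t* *m R1 = b^t* *m Q1.
  by rewrite -[R1]pR1.1 -adjM R1g0 adjM pQ1.1.
clearbody g0.
pose g := qform R1 g0; have g_ge0 : 0 <= g by apply: (posdef_possemidef pR1).2.
(* Completing the square costs [g] times [w^t* *m w]. With this weight the mode [a] contributes
   [g + 1] times it, so that exactly 1 remains. *)
pose m := (g + 1) / - (a + a^*).
have m_gt0 : 0 < m by rewrite divr_gt0 ?oppr_gt0 // ltr_wpDl.
have mE : - m * (a + a^*) = g + 1.
  by rewrite mulNr -mulrN mulfVK // oppr_eq0 lt_eqF.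
have pm1 c : 0 < c -> posdef (c%:M : 'M[C]_1).
  move=> c0; split=> [|v v0].
    by rewrite tr_scalar_mx map_scalar_mx /= geC0_conj // ltW.
  rewrite -[c%:M]mulmx1 mul_scalar_mx qformZ mulr_gt0 //.
  exact: (posdef1 C 1).2.
have PA : P *m A = A1 *m P + b *m w.
  by rewrite -[LHS]mulmx1 -SP mulmxDr !mulmxA.
clearbody A1 b.
exists (P^t* *m Q1 *m P + w^t* *m m%:M *m w); split.
  apply: posdefD_congr => //; first exact: pm1.
  move=> v Pv wv.
  by rewrite -[v]mul1mx -SP mulmxDl -!mulmxA Pv wv !mulmx0 addr0.
suff -> : lyap A (P^t* *m Q1 *m P + w^t* *m m%:M *m w) =
    (P - g0 *m w)^t* *m R1 *m (P - g0 *m w) + w^t* *m 1%:M *m w.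
  apply: posdefD_congr => //; first exact: posdef1.
  move=> v; rewrite mulmxBl -mulmxA => Pv wv.
  move: Pv; rewrite wv mulmx0 subr0 => Pv.
  by rewrite -[v]mul1mx -SP mulmxDl -!mulmxA Pv wv !mulmx0 addr0.
have gE : g0^t* *m R1 *m g0 = g%:M by rewrite [LHS]mx11_scalar.
transitivity (P^t* *m R1 *m P - P^t* *m Q1 *m b *m w - w^t* *m b^t* *m Q1 *m P
   + (- m * (a + a^*)) *: (w^t* *m w)).
  rewrite /lyap.
  have e1 : A^t* *m (P^t* *m Q1 *m P + w^t* *m m%:M *m w) =
     (A1 *m P + b *m w)^t* *m Q1 *m P + (m * a^*) *: (w^t* *m w).
    rewrite -PA adjM mulmxDr !mulmxA -(adjM w A) wA adjZ mul_mx_scalar.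
    by rewrite -!scalemxAl scalerA.
  have e2 : (P^t* *m Q1 *m P + w^t* *m m%:M *m w) *m A =
     P^t* *m Q1 *m (A1 *m P + b *m w) + (m * a) *: (w^t* *m w).
    rewrite -PA mulmxDl !mulmxA mul_mx_scalar -!scalemxAl -!mulmxA wA.
    by rewrite -scalemxAr scalerA.
  rewrite e1 e2 !adjE /R1 /lyap !(mulmxDr, mulmxDl, mulmxN, mulNmx) !mulmxA.
  rewrite mulrDr scalerDl !mulNr !scaleNr !opprD.
  by mx_abel.
rewrite mE !adjE !(mulmxBl, mulmxBr) !mulmxA mulmx1.
rewrite -!(mulmxA (w^t*) (g0^t*)) hg0 -!(mulmxA _ R1 g0) R1g0.
rewrite -(mulmxA (w^t*) (b^t* *m Q1) g0) -hg0 gE mul_mx_scalar hg0 !mulmxA.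
rewrite -scalemxAl scalerDl scale1r.
by mx_abel.
Qed.

(** * Stabilization by output injection *)

(* Output injection decouples the mode [a] of [A + S K1 C] from the hyperplane
   [ker w]; it is then moved to [a - beta] through a right eigenvector [s]. *)
Lemma detectable_stabilizable (C : numClosedFieldType) n m (A : 'M[C]_n)
    (H : 'M[C]_(m, n)) :
  (forall a (v : 'cV[C]_n), A *m v = a *: v -> H *m v = 0 -> v != 0 ->
     a + a^* < 0) ->
  exists K : 'M[C]_(n, m), hurwitzC (A + K *m H).
Proof.
have [N] := ubnP n; elim: N n A H => // N IH [|n] A H; rewrite ltnS => nN hA.
  exists 0 => a /eigenvalueP[v _]; by rewrite [v]thinmx0 eqxx.
have [a0 eA] := @eigenvalue_exists _ _ A (ltn0Sn n).
move: (eA) => /eigenvalueP[w wA w0].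
have [s0 ws0] := dual_vector w0.
have [r [S [P [rn [SP PS Ps wS]]]]] := split_hyperplane ws0.
have AS := invariant_hyperplane wA SP wS.
set A1 := P *m A *m S in AS.
have [b y Ay Hy y0|K1 hK1] := IH r A1 (H *m S) (leq_trans rn nN).
  have [Ay1 Ay2] := eigenvalue_restrict AS PS Ay.
  by apply: (hA b (S *m y)) => //; [rewrite mulmxA | exact: Ay2].
pose At := A + S *m K1 *m H.
have wAt : w *m At = a0 *: w by rewrite mulmxDr wA !mulmxA wS !mul0mx addr0.
have AtS : At *m S = S *m (A1 + K1 *m (H *m S)).
  by rewrite mulmxDl AS mulmxDr !mulmxA.
have row_cases (M : 'M[C]_n.+1) (M1 : 'M[C]_r) (u : 'rV_n.+1) b :
    M *m S = S *m M1 -> u *m M = b *: u -> u *m S != 0 -> eigenvalue M1 b.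
  move=> MS uM uS; apply/eigenvalueP; exists (u *m S) => //.
  by rewrite -mulmxA -MS mulmxA uM scalemxAl.
have [a0neg|a0nneg] := boolP (a0 + a0^* < 0).
  (* A left eigenvector of [At] either is nonzero on the hyperplane, and its eigenvalue belongs to
     the stabilized block, or is a multiple of [w], with eigenvalue [a0]. *)
  exists (S *m K1) => b /eigenvalueP[u uM u0].
  have [uS|uS] := eqVneq (u *m S) 0; last first.
    exact: hK1 (row_cases _ _ _ _ AtS uM uS).
  have uE : u = (u *m s0) *m w.
    by rewrite -{1}[u]mulmx1 -SP mulmxDr mulmxA uS mul0mx add0r mulmxA.
  have : (b - a0) *: u = 0.
    rewrite scalerBl -uM {1}uE -mulmxA wAt -scalemxAr -uE subrr //.
  move/eqP; rewrite scaler_eq0 (negPf u0) orbF subr_eq0 => /eqP -> //.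
have : eigenvalue At a0 by apply/eigenvalueP; exists w.
move=> /eigenvalue_vector[s1 s1E s1n0].
(* Otherwise [s1] would lie in the hyperplane and [a0] would be an eigenvalue of the stabilized
   block. *)
have ws1 : w *m s1 != 0.
  apply/negP => /eqP ws1.
  have s1S : s1 = S *m (P *m s1).
    by rewrite -{1}[s1]mul1mx -SP mulmxDl -!mulmxA ws1 mulmx0 addr0.
  move/negP: a0nneg; apply; apply: hK1; apply/eigenvalue_vector.
  exists (P *m s1); last by apply: contra s1n0 => /eqP h; rewrite s1S h mulmx0.
  rewrite -[LHS]mul1mx -PS -(mulmxA P) (mulmxA S) -AtS -!mulmxA -s1S s1E.
  by rewrite -scalemxAr.
have Hs1 : H *m s1 != 0.
  apply/negP => /eqP Hs1; move/negP: a0nneg; apply.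
  apply: (hA a0 s1) => //.
  by rewrite -s1E mulmxDl -!mulmxA Hs1 !mulmx0 addr0.
have [c cH] : exists c : 'rV[C]_m, c *m (H *m s1) = 1%:M.
  have [|c hc] := @dual_vector _ _ (H *m s1)^T; first by rewrite trmx_eq0.
  by exists c^T; rewrite -[H *m s1]trmxK -trmx_mul hc trmx1.
(* The correction moves the eigenvalue of [s1] from [a0] to -1, while left eigenvectors that
   annihilate [s1] are unaffected by it. *)
pose beta := a0 + 1.
exists (S *m K1 - beta *: (s1 *m c)) => b.
have -> : A + (S *m K1 - beta *: (s1 *m c)) *m H = At - beta *: (s1 *m (c *m H)).
  by rewrite mulmxBl -scalemxAl -!mulmxA addrA /At mulmxA.
move=> /eigenvalueP[u uM u0].
have e1 : (b - (a0 - beta)) *: (u *m s1) = 0.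
  rewrite scalerBl scalemxAl -uM -mulmxA mulmxBl s1E -scalemxAl.
  rewrite -(mulmxA s1) -(mulmxA c) cH mulmx1 -scalerBl -scalemxAr subrr //.
have [us1|us1] := eqVneq (u *m s1) 0; last first.
  move/eqP: e1; rewrite scaler_eq0 (negPf us1) orbF subr_eq0 => /eqP ->.
  have -> : a0 - beta = -1 by rewrite /beta opprD addrA subrr add0r.
  by rewrite rmorphN rmorph1 -opprD oppr_lt0 addr_gt0.
have uAt : u *m At = b *: u.
  by rewrite -uM mulmxBr -scalemxAr (mulmxA u) us1 mul0mx scaler0 subr0.
have uS : u *m S != 0.
  apply: contra u0 => /eqP uS.
  have uE : u = (u *m s0) *m w.
    by rewrite -{1}[u]mulmx1 -SP mulmxDr mulmxA uS mul0mx add0r mulmxA.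
  move: us1; rewrite uE -mulmxA [u *m s0]mx11_scalar mul_scalar_mx => /eqP.
  by rewrite scaler_eq0 (negPf ws1) orbF => /eqP ->; rewrite mul_scalar_mx scale0r.
exact: hK1 (row_cases _ _ _ _ AtS uAt uS).
Qed.

(* With [R = lyap (A + K H) Q], the weight [W] is what completing the square in
   [R + K^* Q + Q K H + H^* W H] requires. *)
Lemma stabilizable_lmi (C : numClosedFieldType) n m (A : 'M[C]_n)
    (H : 'M[C]_(m, n)) (K : 'M[C]_(n, m)) :
  hurwitzC (A + K *m H) ->
  exists Q W, [/\ posdef Q, possemidef W & posdef (lyap A Q + H^t* *m W *m H)].
Proof.
move=> /hurwitz_lyap[Q [pQ pR]]; set R := lyap _ _ in pR.
have Ru := posdef_unitmx pR.
pose G := invmx R *m (Q *m K).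
have RG : R *m G = Q *m K by rewrite mulKVmx.
have GR : G^t* *m R = K^t* *m Q by rewrite -[R]pR.1 -adjM RG adjM pQ.1.
(* The summand [1%:M] of the weight leaves [H^t* *m H] beside the completed square. The sum is
   definite, because the square reduces to [R] where [H] vanishes. *)
exists Q, (G^t* *m R *m G + 1%:M^t* *m 1%:M *m 1%:M); split=> //.
  apply: posdef_possemidef; apply: posdefD_congr => //; first exact: posdef1.
  by move=> v _; rewrite mul1mx.
suff -> : lyap A Q + H^t* *m (G^t* *m R *m G + 1%:M^t* *m 1%:M *m 1%:M) *m H =
   (1%:M + G *m H)^t* *m R *m (1%:M + G *m H) + H^t* *m 1%:M *m H.
  apply: posdefD_congr => //; first exact: posdef1.
  by move=> v; rewrite mulmxDl -mulmxA mul1mx => + Hv; rewrite Hv mulmx0 addr0.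
have -> : lyap A Q = R + H^t* *m (K^t* *m Q) + Q *m K *m H.
  rewrite /R /lyap !adjE !(mulmxDl, mulmxDr) !mulmxA.
  by mx_abel.
rewrite -GR -RG !adjE !(mulmxDl, mulmxDr) !(mul1mx, mulmx1) !mulmxA.
clearbody G R; by mx_abel.
Qed.

(** Converts the sign of the Lyapunov form at one vector into the sign of the real part of an
    eigenvalue. *)
Lemma lyap_eigenvector (C : numClosedFieldType) n (F Q : 'M[C]_n) a v :
  Q^t* = Q -> F *m v = a *: v ->
  qform (lyap F Q) v = - (a + a^*) * qform Q v.
Proof.
move=> hQ Fv; rewrite /qform /lyap mulmxN mulNmx mxE mulNr; congr (- _).
have e1 : v^t* *m (F^t* *m Q) *m v = a^* *: (v^t* *m Q *m v).
  by rewrite mulmxA -adjM Fv adjZ -!scalemxAl.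
have e2 : v^t* *m (Q *m F) *m v = a *: (v^t* *m Q *m v).
  by rewrite -!mulmxA Fv -!scalemxAr.
by rewrite mulmxDr mulmxDl e1 e2 -scalerDl [LHS]mxE addrC.
Qed.

(** The factor [invmx Q] cancels [Q], so the feedback adds a Hermitian term that depends on [l]
    through its real part only. This is why one gain serves all complex couplings. *)
Lemma lyap_feedback (C : numClosedFieldType) n m (A : 'M[C]_n)
    (H : 'M[C]_(m, n)) Q W k l :
  posdef Q -> W^t* = W -> k^* = k ->
  lyap (A + l *: ((k *: (invmx Q *m H^t* *m W)) *m H)) Q =
  lyap A Q + (- (l + l^*) * k) *: (H^t* *m W *m H).
Proof.
move=> pQ hW hk; have Qu := posdef_unitmx pQ.
have e : Q *m (l *: (k *: (invmx Q *m H^t* *m W) *m H)) =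
    (l * k) *: (H^t* *m W *m H).
  by rewrite -!scalemxAl -!scalemxAr scalerA !mulmxA mulmxV // mul1mx.
have e0 : (l * k)^* = l^* * k by rewrite -{2}hk -rmorphM.
have e' : (l *: (k *: (invmx Q *m H^t* *m W) *m H))^t* *m Q =
    (l^* * k) *: (H^t* *m W *m H).
  by rewrite -[X in _ *m X]pQ.1 -adjM e !adjE e0 hW mulmxA.
rewrite /lyap adjD mulmxDl mulmxDr e e' mulNr mulrDl scaleNr scalerDl.
by mx_abel.
Qed.

(** As [W] is semidefinite, a coefficient of at least 1 makes the feedback term dominate
    [H^t* *m W *m H]. *)
Lemma hurwitz_lmi_gain (C : numClosedFieldType) n m (A : 'M[C]_n)
    (H : 'M[C]_(m, n)) Q W k l :
  posdef Q -> possemidef W -> posdef (lyap A Q + H^t* *m W *m H) ->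
  0 < k -> 1 <= - (l + l^*) * k ->
  hurwitzC (A + l *: ((k *: (invmx Q *m H^t* *m W)) *m H)).
Proof.
move=> pQ pW pS k0 lk a /eigenvalue_vector[v Fv v0].
have := lyap_eigenvector pQ.1 Fv.
rewrite (lyap_feedback _ _ _ pQ pW.1 (geC0_conj (ltW k0))) qformD qformZ => e.
have : 0 < - (a + a^*) * qform Q v.
  rewrite -e; apply: lt_le_trans (pS.2 v v0) _.
  by rewrite qformD lerD2l qform_congr ler_peMl // pW.2.
by rewrite mulNr oppr_gt0 pmulr_llt0 // pQ.2.
Qed.

(** If the output sees the eigenvector, the feedback term is strictly positive; if not, it is an
    eigenvector of [A] itself and the detectability test applies. The gain has the shape of
    [lyap_feedback] with [k = 1] and [W = 1%:M]. *)
Lemma hurwitz_passive_gain (C : numClosedFieldType) n m (A : 'M[C]_n)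
    (H : 'M[C]_(m, n)) Q l :
  posdef Q -> possemidef (lyap A Q) ->
  (forall a (v : 'cV[C]_n), A *m v = a *: v -> H *m v = 0 -> v != 0 ->
     a + a^* < 0) ->
  l + l^* < 0 ->
  hurwitzC (A + l *: ((1 *: (invmx Q *m H^t* *m 1%:M)) *m H)).
Proof.
move=> pQ pS hA l0 a /eigenvalue_vector[v Fv v0].
have [Hv|Hv] := eqVneq (H *m v) 0.
  by apply: (hA a v) => //; rewrite -Fv mulmxDl -(scalemxAl l) -(mulmxA _ H v) Hv mulmx0
    scaler0 addr0.
have := lyap_eigenvector pQ.1 Fv.
rewrite (lyap_feedback _ _ _ pQ (adj1 _ _) (conjC1 _)) qformD qformZ qform_congr mulr1 => e.
have : 0 < - (a + a^*) * qform Q v.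
  rewrite -e ltr_wpDl ?pS.2 // mulr_gt0 ?oppr_gt0 //.
  exact: (posdef1 _ _).2.
by rewrite mulNr oppr_gt0 pmulr_llt0 // pQ.2.
Qed.

(** * Real parts of complex forms *)

Notation cmx A := (map_mx (real_complex _) A).

Lemma qform_conj (C : numClosedFieldType) n (Q : 'M[C]_n) v :
  qform (map_mx Num.conj Q) v = (qform Q (map_mx Num.conj v))^*.
Proof.
rewrite /qform !mxE rmorph_sum; apply: eq_bigr => i _.
rewrite !mxE rmorphM /= rmorph_sum conjCK; congr (_ * _).
by apply: eq_bigr => j _; rewrite !mxE rmorphM /= conjCK.
Qed.

Lemma cmx_adj (R : rcfType) m n (A : 'M[R]_(m, n)) : (cmx A)^t* = cmx A^T.
Proof. by apply/matrixP => i j; rewrite !mxE; exact: conjc_real. Qed.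

Lemma cmx_conj (R : rcfType) m n (A : 'M[R]_(m, n)) :
  map_mx Num.conj (cmx A) = cmx A.
Proof. by apply/matrixP => i j; rewrite !mxE; exact: conjc_real. Qed.

Lemma cmx_Re (R : rcfType) m n (A : 'M[R[i]]_(m, n)) :
  cmx (map_mx (@complex.Re R) A) = 2^-1 *: (A + map_mx Num.conj A).
Proof. by apply/matrixP => i j; rewrite !mxE ReJ_add mulrC. Qed.

(** The real part is the mean of [Q] and its conjugate, and the conjugate form takes conjugates of
    values of [Q]. *)
Lemma possemidef_Re (R : rcfType) n (Q : 'M[R[i]]_n) :
  possemidef Q -> possemidef (cmx (map_mx (@complex.Re R) Q)).
Proof.
case=> hQ pQ; rewrite cmx_Re; split=> [|v].
  rewrite adjZ adjD geC0_conj ?invr_ge0 ?ler0n //; congr (_ *: _).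
  rewrite hQ -[in X in _ = _ + X]hQ; congr (_ + _).
  by apply/matrixP => i j; rewrite !mxE.
rewrite qformZ qformD qform_conj; apply: mulr_ge0; first by rewrite invr_ge0 ler0n.
by rewrite addr_ge0 ?conjC_ge0.
Qed.

Lemma posdef_Re (R : rcfType) n (Q : 'M[R[i]]_n) :
  posdef Q -> posdef (cmx (map_mx (@complex.Re R) Q)).
Proof.
move=> pQ; split=> [|v v0]; first exact: (possemidef_Re (posdef_possemidef pQ)).1.
have v1 : map_mx Num.conj v != 0.
  apply: contra v0 => /eqP/matrixP h; apply/eqP/matrixP => i j.
  by move: (h i j); rewrite !mxE => /eqP; rewrite conjC_eq0 => /eqP.
rewrite cmx_Re qformZ qformD qform_conj; apply: mulr_gt0.
  by rewrite invr_gt0 ltr0n.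
have p1 := pQ.2 _ v1.
by rewrite geC0_conj ?ltW // addr_gt0 // pQ.2.
Qed.

(** As [A] is real, conjugation commutes with the Lyapunov operator. *)
Lemma lyap_Re (R : rcfType) n (A : 'M[R]_n) (Q : 'M[R[i]]_n) :
  lyap (cmx A) (cmx (map_mx (@complex.Re R) Q)) =
  cmx (map_mx (@complex.Re R) (lyap (cmx A) Q)).
Proof.
rewrite !cmx_Re /lyap map_mxN map_mxD !map_mxM cmx_adj !cmx_conj.
rewrite -scalemxAl -scalemxAr -scalerDr -scalerN; congr (_ *: _).
rewrite mulmxDl mulmxDr.
by mx_abel.
Qed.

(** * Gains *)

Lemma addcJ_lt0 (R : rcfType) (a : R[i]) : (a + a^* < 0) = (complex.Re a < 0).
Proof.
have -> : a + a^* = (2 * complex.Re a)%:C%C.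
  by rewrite rmorphM rmorph_nat; exact: addcJ.
by rewrite -[0]/(0%:C)%C ltcR pmulr_rlt0.
Qed.

Lemma addcJ_le0 (R : rcfType) (a : R[i]) : (a + a^* <= 0) = (complex.Re a <= 0).
Proof.
have -> : a + a^* = (2 * complex.Re a)%:C%C.
  by rewrite rmorphM rmorph_nat; exact: addcJ.
by rewrite -[0]/(0%:C)%C lecR pmulr_rle0.
Qed.

(* The Popov-Belevitch-Hautus form of detectability. *)
Definition hautus (R : rcfType) n m (A : 'M[R]_n) (H : 'M[R]_(m, n)) :=
  forall (a : R[i]) (v : 'cV[R[i]]_n),
    cmx A *m v = a *: v -> cmx H *m v = 0 -> v != 0 -> a + a^* < 0.

(** The matrix inequality is linear in [Q] and [W] with real coefficients, so it survives passing to
    real parts, which yield a real gain independent of [l]. *)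
Lemma gain_detectable (R : rcfType) n m (A : 'M[R]_n) (H : 'M[R]_(m, n)) d :
  hautus A H -> 0 < d -> exists L : 'M[R]_(n, m),
  forall l : R[i], complex.Re l <= - d -> hurwitzC (cmx A + l *: cmx (L *m H)).
Proof.
move=> hAH d0; have [K hK] := detectable_stabilizable hAH.
have [Q [W [pQ pW pS]]] := stabilizable_lmi hK.
pose Q1 := map_mx (@complex.Re R) Q; pose W1 := map_mx (@complex.Re R) W.
have pS1 : posdef (lyap (cmx A) (cmx Q1) + (cmx H)^t* *m cmx W1 *m cmx H).
  have -> : lyap (cmx A) (cmx Q1) + (cmx H)^t* *m cmx W1 *m cmx H =
     cmx (map_mx (@complex.Re R) (lyap (cmx A) Q + (cmx H)^t* *m W *m cmx H)).
    rewrite lyap_Re !cmx_Re map_mxD !map_mxM cmx_adj !cmx_conj.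
    rewrite -scalemxAr -scalemxAl -scalerDr mulmxDr mulmxDl; congr (_ *: _).
    by mx_abel.
  exact: posdef_Re.
(* For [Re l <= - d] this makes the coefficient of the feedback term at least 1. *)
pose k := (2 * d)^-1; have k0 : 0 < k by rewrite invr_gt0 mulr_gt0.
exists (k *: (invmx Q1 *m H^T *m W1)) => l ld.
have -> : cmx ((k *: (invmx Q1 *m H^T *m W1)) *m H) =
   ((k%:C)%C *: (invmx (cmx Q1) *m (cmx H)^t* *m cmx W1)) *m cmx H.
  by rewrite map_mxM map_mxZ !map_mxM map_invmx cmx_adj.
apply: (@hurwitz_lmi_gain _ _ _ (cmx A) (cmx H) (cmx Q1) (cmx W1) (k%:C)%C l).
- exact: posdef_Re.
- exact: possemidef_Re.
- exact: pS1.
- by rewrite -[0]/(0%:C)%C ltcR.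
- have -> : l + l^* = (2 * complex.Re l)%:C%C.
    by rewrite rmorphM rmorph_nat; exact: addcJ.
  rewrite -rmorphN -rmorphM -[1]/(1%:C)%C lecR -mulrN.
  by rewrite ler_pdivlMr ?mulr_gt0 // mul1r ler_pM2l // lerNr.
Qed.

Lemma gain_passive (R : rcfType) n m (A : 'M[R]_n) (H : 'M[R]_(m, n)) Q :
  hautus A H -> posdef Q -> possemidef (lyap (cmx A) Q) ->
  exists L : 'M[R]_(n, m),
  forall l : R[i], complex.Re l < 0 -> hurwitzC (cmx A + l *: cmx (L *m H)).
Proof.
move=> hAH pQ pS; pose Q1 := map_mx (@complex.Re R) Q.
exists (1 *: (invmx Q1 *m H^T *m 1%:M)) => l l0.
have -> : cmx ((1 *: (invmx Q1 *m H^T *m 1%:M)) *m H) =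
   (1 *: (invmx (cmx Q1) *m (cmx H)^t* *m 1%:M)) *m cmx H.
  by rewrite map_mxM map_mxZ !map_mxM map_invmx cmx_adj map_mx1.
apply: (@hurwitz_passive_gain _ _ _ (cmx A) (cmx H) (cmx Q1) l).
- exact: posdef_Re.
- by rewrite lyap_Re; exact: possemidef_Re.
- exact: hAH.
- by rewrite addcJ_lt0.
Qed.

Lemma gain_row_full (R : realType) n m (A : 'M[R]_n) (H : 'M[R]_(m, n)) :
  row_full H -> no_unstable_eigenvalue A -> exists L : 'M[R]_(n, m),
  forall l : R[i], complex.Re l < 0 -> hurwitzC (cmx A + l *: cmx (L *m H)).
Proof.
move=> /row_fullP[L LH] hA; exists L => l l0 a /eigenvalue_vector[v Fv v0].
rewrite addcJ_lt0; have -> : a = (a - l) + l by rewrite subrK.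
rewrite raddfD /=; apply: ltr_wnDl => //; apply: hA.
apply/eigenvalue_vector; exists v => //.
by rewrite scalerBl -Fv LH map_mx1 mulmxDl -scalemxAl mul1mx addrK.
Qed.

Lemma hurwitz_cmx (R : realType) n (A : 'M[R]_n) :
  hurwitz A -> hurwitzC (cmx A).
Proof. by move=> hA a /hA; rewrite addcJ_lt0. Qed.

(** If [a] differs from [l], comparing the columns of the eigenvector equation from left to right
    kills the coordinates of [v] one after another. *)
Lemma jordan_block_eigenvalue (F : fieldType) s (l a : F) :
  eigenvalue (jordan_block s l) a -> a = l.
Proof.
move=> /eigenvalueP[v vJ v0]; apply/eqP; apply: contraT => al.
suff v0' k (ks : (k < s)%N) : v 0 (Ordinal ks) = 0.
  move/eqP: v0; case; apply/matrixP => i j; rewrite ord1 mxE.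
  by rewrite -(v0' j (ltn_ord j)); congr (v _ _); apply: val_inj.
elim: k ks => [|k IH] ks.
  move/matrixP: vJ => /(_ 0 (Ordinal ks)); rewrite !mxE (bigD1 (Ordinal ks)) //=.
  rewrite !mxE eqxx addr0 big1 => [|i ik]; last first.
    by rewrite !mxE eq_sym (negPf ik) mulr0n add0r mulr0.
  move/eqP; rewrite addr0 mulrC mulr1n -subr_eq0 -mulrBl mulf_eq0 subr_eq0 eq_sym.
  by rewrite (negPf al) => /eqP.
move/matrixP: vJ => /(_ 0 (Ordinal ks)); rewrite !mxE (bigD1 (Ordinal ks)) //=.
rewrite !mxE eqxx ltn_eqF // addr0.
rewrite (bigD1 (Ordinal (ltnW ks))) /=; last by rewrite -val_eqE /= ltn_eqF.
rewrite IH mul0r add0r big1 => [|i /andP[ik ik']]; last first.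
  rewrite !mxE eq_sym (negPf ik) mulr0n add0r.
  have -> : (k.+1 == i.+1)%N = false; last by rewrite mulr0.
  by apply/negbTE; apply: contra ik' => /eqP [e]; rewrite -val_eqE /= e.
move/eqP; rewrite addr0 mulrC mulr1n -subr_eq0 -mulrBl mulf_eq0 subr_eq0 eq_sym.
by rewrite (negPf al) => /eqP.
Qed.

(** * Neutral stability *)

Lemma map_mxdiag (C : numClosedFieldType) k (s : 'I_k -> nat)
    (B : forall i, 'M[C]_(s i)) :
  map_mx Num.conj (\mxdiag_i B i) = \mxdiag_i map_mx Num.conj (B i).
Proof.
apply/matrixP => i j; rewrite !mxE.
move: (tagnat.sig2 i) (tagnat.sig2 j); case: eqVneq => [<-|_] x y.
  by rewrite !conform_mx_id mxE.
by rewrite !mxE rmorph0.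
Qed.

Lemma mxdiag_form (C : numClosedFieldType) k (s : 'I_k -> nat)
    (B : forall i, 'M[C]_(s i)) (u v : forall i, 'cV[C]_(s i)) :
  ((\mxcol_i u i)^t* *m (\mxdiag_i B i) *m (\mxcol_i v i)) 0 0 =
  \sum_i ((u i)^t* *m B i *m v i) 0 0.
Proof.
have -> : (\mxcol_i u i)^t* = \mxrow_i (u i)^t*.
  by rewrite tr_mxcol; apply/matrixP => i j; rewrite !mxE.
rewrite -mulmxA mul_mxdiag_mxcol mul_mxrow_mxcol summxE.
by apply: eq_bigr => i _; rewrite mulmxA.
Qed.

Lemma qform_mxdiag (C : numClosedFieldType) k (s : 'I_k -> nat)
    (B : forall i, 'M[C]_(s i)) v :
  qform (\mxdiag_i B i) v = \sum_i qform (B i) (submxcol v i).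
Proof. by rewrite /qform -[in LHS](submxcolK v) mxdiag_form. Qed.

Lemma qform_lyap (C : numClosedFieldType) n (F Q : 'M[C]_n) v :
  qform (lyap F Q) v =
  - (((F *m v)^t* *m Q *m v) 0 0 + (v^t* *m Q *m (F *m v)) 0 0).
Proof.
rewrite /qform /lyap mulmxN mulNmx mxE; congr (- _).
by rewrite mulmxDr mulmxDl mxE adjM !mulmxA.
Qed.

Lemma qform_lyap_mxdiag (C : numClosedFieldType) k (s : 'I_k -> nat)
    (F B : forall i, 'M[C]_(s i)) v :
  qform (lyap (\mxdiag_i F i) (\mxdiag_i B i)) v =
  \sum_i qform (lyap (F i) (B i)) (submxcol v i).
Proof.
rewrite qform_lyap -[in LHS](submxcolK v) mul_mxdiag_mxcol !mxdiag_form.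
by rewrite -big_split -sumrN; apply: eq_bigr => i _; rewrite qform_lyap.
Qed.

Lemma posdef_mxdiag (C : numClosedFieldType) k (s : 'I_k -> nat)
    (B : forall i, 'M[C]_(s i)) :
  (forall i, posdef (B i)) -> posdef (\mxdiag_i B i).
Proof.
move=> pB; split=> [|v v0].
  by rewrite tr_mxdiag map_mxdiag; apply: eq_mxdiag => i; case: (pB i).
rewrite qform_mxdiag.
have pos i : 0 <= qform (B i) (submxcol v i) by apply: (posdef_possemidef (pB i)).2.
rewrite lt_def sumr_ge0 // andbT; apply: contra v0.
rewrite psumr_eq0 // => /allP h; apply/eqP/mxcolP => i; rewrite submxcol0.
apply/eqP; apply: contraT => /(pB i).2.
by have := h i (mem_index_enum _) => /eqP ->; rewrite ltxx.
Qed.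

(** The form is chosen block by block: a block on the imaginary axis is scalar and admits the
    identity, any other block is Hurwitz and has a Lyapunov matrix. The change of basis transports
    the block-diagonal form. *)
Lemma neutrally_stable_lyap (R : realType) n (A : 'M[R]_n) :
  neutrally_stable A ->
  exists Q, posdef Q /\ possemidef (lyap (cmx A) Q).
Proof.
move=> [hA [k [s [l [[s0 [T [T' [TT' T'T AE]]]] sl]]]]].
pose J i := jordan_block (s i) (l i).
have l_le0 i : complex.Re (l i) <= 0.
  apply: hA; apply/eigenvalue_vector.
  (* The first basis vector of block [i], zero in the other blocks; [T] maps it to an eigenvector
     for [l i]. *)
  pose e j := \col_(a < s j) ((j == i) && (a == 0%N :> nat))%:R : 'cV[R[i]]_(s j).
  exists (T *m \mxcol_j e j).
    rewrite AE -!mulmxA (mulmxA T') T'T mul1mx mul_mxdiag_mxcol scalemxAr.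
    congr (_ *m _); apply/matrixP => a b; rewrite !mxE.
    move: (tagnat.sig1 a) (tagnat.sig2 a) => j c.
    case: (eqVneq j i) c => [->|ji] c; last first.
      by rewrite mulr0 big1 // => x _; rewrite !mxE (negPf ji) mulr0.
    rewrite (bigD1 (Ordinal (s0 i))) //= !mxE !eqxx /= mulr1.
    rewrite big1 ?addr0 => [|x x0]; last first.
      rewrite !mxE eqxx /=; have -> : (x == 0%N :> nat) = false.
        by apply/negbTE; apply: contra x0 => /eqP e0; apply/eqP/val_inj.
      by rewrite mulr0.
    rewrite -val_eqE /= eq_sym; case: (_ == _ :> nat).
      by rewrite ?mulr1 ?mulr1n.
    by rewrite ?mulr0 ?mulr0n.
  apply/negP => /eqP h; have : \mxcol_j e j = 0.
    by rewrite -[LHS]mul1mx -T'T -mulmxA h mulmx0.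
  move=> /(congr1 (fun v => submxcol v i)); rewrite mxcolK submxcol0.
  move=> /matrixP/(_ (Ordinal (s0 i)) 0); rewrite !mxE eqxx /=.
  by move/eqP; rewrite oner_eq0.
have hQ i : exists Q, posdef Q /\ possemidef (lyap (J i) Q).
  have [l0|l0] := eqVneq (complex.Re (l i)) 0.
    exists 1%:M; split; first exact: posdef1.
    have JE : J i = (l i)%:M.
      apply/matrixP => a b; rewrite !mxE.
      have ab : a = b.
        have s1 := sl _ l0; apply: val_inj.
        have le0 (x : 'I_(s i)) : x = 0%N :> nat.
          have : (x < 1)%N by rewrite (leq_trans (ltn_ord x)) // s1.
          by case: (nat_of_ord x).
        by rewrite /= !le0.
      by rewrite ab eqxx ltn_eqF // addr0.
    split=> [|v]; first by apply: lyap_adj; exact: adj1.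
    rewrite (lyap_eigenvector (a := l i)) ?adj1 ?JE ?mul_scalar_mx //.
    rewrite mulr_ge0 ?oppr_ge0 ?addcJ_le0 //.
    exact: (posdef_possemidef (posdef1 _ _)).2.
  have [|Q [pQ pL]] := @hurwitz_lyap _ _ (J i).
    by move=> a /jordan_block_eigenvalue ->; rewrite addcJ_lt0 lt_neqAle l0 l_le0.
  by exists Q; split=> //; exact: posdef_possemidef.
have [Q hQi] := fin_all_exists hQ.
have pD : posdef (\mxdiag_i Q i) by apply: posdef_mxdiag => i; case: (hQi i).
exists (T'^t* *m (\mxdiag_i Q i) *m T'); split; first exact: posdef_congr TT' pD.
set D := \mxdiag_i _ in pD *.
have -> : lyap (cmx A) (T'^t* *m D *m T') =
    T'^t* *m lyap (\mxdiag_i J i) D *m T'.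
  rewrite /lyap AE !adjE !(mulmxDl, mulmxDr, mulmxN, mulNmx) !mulmxA.
  rewrite -(mulmxA _ (T^t*) (T'^t*)) -(adjM T' T) T'T adj1 mulmx1.
  by rewrite -(mulmxA _ T' T) T'T mulmx1.
apply: possemidef_congr; split=> [|v]; first exact: lyap_adj pD.1.
by rewrite qform_lyap_mxdiag sumr_ge0 // => i _; case: (hQi i) => _ [].
Qed.

(** * Asymptotics of solutions *)

Lemma derive_le0_le (R : realType) (h h' : R -> R) (a : R) :
  (forall t, a < t -> is_derive t (1 : R) h (h' t)) ->
  (forall t, a < t -> h' t <= 0) ->
  forall s t, a < s -> s <= t -> h t <= h s.
Proof.
move=> dh h0 s t sa st.
move: st; rewrite le_eqVlt => /predU1P[-> //|st].
have dh' x : x \in `]s, t[%R -> is_derive x (1 : R) h (h' x).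
  by rewrite in_itv /= => /andP[sx _]; apply/dh/(lt_trans sa).
have ch : {within `[s, t], continuous h}.
  apply: derivable_within_continuous => x; rewrite in_itv /= => /andP[sx _].
  by have [] := dh x (lt_le_trans sa sx).
have [x xst e] := MVT st dh' ch; have /andP[sx _] : s < x < t by rewrite in_itv in xst.
rewrite -subr_le0 e. apply: mulr_le0_ge0; last by rewrite subr_ge0 ltW.
exact/h0/(lt_trans sa).
Qed.

(* For each [b > 0], [expR (c * t) * (V t - b)] is eventually nonincreasing. *)
Lemma decay (R : realType) (V V' d : R -> R) (c : R) :
  0 < c -> (forall t : R, 0 < t -> is_derive t (1 : R) V (V' t)) ->
  (forall t : R, 0 < t -> 0 <= V t) ->
  (forall t : R, 0 < t -> V' t <= - c * V t + d t) ->
  d t @[t --> +oo] --> (0 : R) -> V t @[t --> +oo] --> (0 : R).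
Proof.
move=> c0 dV V0 V'le d0; apply/cvgrPdist_lt => e e0.
pose b := e / 2; have b0 : 0 < b by rewrite divr_gt0.
have [T [Treal dT]] : \forall t \near +oo, `|0 - d t| < c * b.
  by move/cvgrPdist_lt : d0; apply; rewrite mulr_gt0.
pose T1 := Num.max T 1.
have TT1 t : T1 < t -> 0 < t /\ d t <= c * b.
  rewrite gt_max => /andP[tT t1]; split; first exact: lt_trans t1.
  by have := dT t tT; rewrite sub0r normrN => /ltW; exact/le_trans/ler_norm.
pose h (t : R) := expR (c * t) * (V t - b).
pose h' (t : R) := expR (c * t) * (c * (V t - b) + V' t).
have dh t : T1 < t -> is_derive t (1 : R) h (h' t).
  move=> /TT1[t0 _]; have := dV t t0 => dVt; rewrite /h /h'.
  apply: is_derive_eq; rewrite /GRing.scale /= !mulr1 oppr0 addr0.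
  ring.
have h'0 t : T1 < t -> h' t <= 0.
  move=> /TT1[t0 dt]; rewrite /h' pmulr_rle0 ?expR_gt0 //.
  have := V'le t t0; lra.
have hle := derive_le0_le dh h'0.
have T2 : T1 < T1 + 1 by rewrite ltrDl.
set M := `|h (T1 + 1)|.
near=> t.
have t1 : T1 + 1 <= t by near: t; apply: nbhs_pinfty_ge; rewrite num_real.
have t0 : 0 < t by case: (TT1 t); rewrite ?(lt_le_trans T2).
have ht : h t <= M by rewrite (le_trans (hle _ _ T2 t1)) // ler_norm.
rewrite sub0r normrN ger0_norm ?V0 //.
(* As [h t <= M], it is enough that [expR (c * t) * b] exceeds [M], which
   [1 + c * t <= expR (c * t)] ensures for large [t]. *)
suff : expR (c * t) * (V t - b) < expR (c * t) * b.
  by rewrite ltr_pM2l ?expR_gt0 // ltrBlDl /b -splitr.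
apply: le_lt_trans ht _; rewrite -ltr_pdivrMr //.
apply: lt_le_trans (expR_ge1Dx _).
have : M / b / c < t by near: t; apply: nbhs_pinfty_gt; rewrite num_real.
rewrite ltr_pdivrMr // mulrC => /lt_trans; apply; lra.
Unshelve. all: by end_near. Qed.

(** * Complex-valued functions of real time *)

Definition vanish (R : realType) (f : R -> R[i]) : Prop :=
  (complex.Re (f t) @[t --> +oo] --> (0 : R)) /\
  (complex.Im (f t) @[t --> +oo] --> (0 : R)).

Definition cderive (R : realType) (f f' : R -> R[i]) : Prop :=
  forall t : R, 0 < t ->
    is_derive t (1 : R) (fun s => complex.Re (f s)) (complex.Re (f' t)) /\
    is_derive t (1 : R) (fun s => complex.Im (f s)) (complex.Im (f' t)).

Lemma ReM (R : rcfType) (x y : R[i]) :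
  complex.Re (x * y) = complex.Re x * complex.Re y - complex.Im x * complex.Im y.
Proof. by case: x => a b; case: y. Qed.

Lemma ImM (R : rcfType) (x y : R[i]) :
  complex.Im (x * y) = complex.Re x * complex.Im y + complex.Im x * complex.Re y.
Proof. by case: x => a b; case: y. Qed.

Lemma ReD (R : rcfType) (x y : R[i]) :
  complex.Re (x + y) = complex.Re x + complex.Re y.
Proof. by case: x => a b; case: y. Qed.

Lemma ImD (R : rcfType) (x y : R[i]) :
  complex.Im (x + y) = complex.Im x + complex.Im y.
Proof. by case: x => a b; case: y. Qed.

Lemma eq_vanish (R : realType) (f g : R -> R[i]) : f =1 g -> vanish f -> vanish g.
Proof. by move=> /funext ->. Qed.

Lemma vanish0 (R : realType) : @vanish R (fun=> 0).
Proof. by split; exact: cvg_cst. Qed.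

Lemma vanishD (R : realType) (f g : R -> R[i]) :
  vanish f -> vanish g -> vanish (fun t => f t + g t).
Proof.
move=> [f1 f2] [g1 g2]; split.
  have h := cvgD f1 g1; rewrite addr0 in h.
  by under eq_fun do rewrite ReD; exact: h.
have h := cvgD f2 g2; rewrite addr0 in h.
by under eq_fun do rewrite ImD; exact: h.
Qed.

Lemma vanishM (R : realType) (c : R[i]) f :
  vanish f -> vanish (fun t => c * f t).
Proof.
move=> [f1 f2]; split.
  have h := cvgB (cvgMl_tmp (a := complex.Re c) f1) (cvgMl_tmp (a := complex.Im c) f2).
  rewrite !mulr0 subr0 in h; by under eq_fun do rewrite ReM; exact: h.
have h := cvgD (cvgMl_tmp (a := complex.Re c) f2) (cvgMl_tmp (a := complex.Im c) f1).
rewrite !mulr0 addr0 in h; by under eq_fun do rewrite ImM; exact: h.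
Qed.

Lemma cderive_eq (R : realType) (f g f' g' : R -> R[i]) :
  (forall t, f t = g t) -> (forall t, f' t = g' t) -> cderive f f' -> cderive g g'.
Proof. by move=> /funext -> /funext ->. Qed.

Lemma cderive0 (R : realType) : @cderive R (fun=> 0) (fun=> 0).
Proof. by move=> t _; split; exact: is_derive_cst. Qed.

Lemma cderiveD (R : realType) (f g f' g' : R -> R[i]) :
  cderive f f' -> cderive g g' ->
  cderive (fun t => f t + g t) (fun t => f' t + g' t).
Proof.
move=> df dg t t0; have [f1 f2] := df t t0; have [g1 g2] := dg t t0; split.
  by under eq_fun do rewrite ReD; rewrite ReD; exact: is_deriveD.
by under eq_fun do rewrite ImD; rewrite ImD; exact: is_deriveD.
Qed.

Lemma cderiveM (R : realType) (c : R[i]) f f' :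
  cderive f f' -> cderive (fun t => c * f t) (fun t => c * f' t).
Proof.
move=> df t t0; have [f1 f2] := df t t0; split.
  under eq_fun do rewrite ReM; rewrite ReM.
  by apply: is_derive_eq; rewrite /GRing.scale /=; ring.
under eq_fun do rewrite ImM; rewrite ImM.
by apply: is_derive_eq; rewrite /GRing.scale /=; ring.
Qed.

Lemma cderive_sum (R : realType) (I : finType) (f f' : I -> R -> R[i]) :
  (forall i, cderive (f i) (f' i)) ->
  cderive (fun t => \sum_i f i t) (fun t => \sum_i f' i t).
Proof.
move=> df; elim: (index_enum I) => [|i s IH].
  by apply: cderive_eq (@cderive0 R) => t; rewrite big_nil.
by apply: cderive_eq (cderiveD (df i) IH) => t; rewrite big_cons.
Qed.

Lemma vanish_sum (R : realType) (I : finType) (f : I -> R -> R[i]) :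
  (forall i, vanish (f i)) -> vanish (fun t => \sum_i f i t).
Proof.
move=> vf; elim: (index_enum I) => [|i s IH].
  by apply: eq_vanish (@vanish0 R) => t; rewrite big_nil.
by apply: eq_vanish (vanishD (vf i) IH) => t; rewrite big_cons.
Qed.

Lemma cderive_real (R : realType) (f f' : R -> R) :
  (forall t : R, 0 < t -> is_derive t (1 : R) f (f' t)) ->
  cderive (fun t => (f t)%:C%C) (fun t => (f' t)%:C%C).
Proof. by move=> df t t0; split; [exact: df | exact: is_derive_cst]. Qed.

Lemma sqr_cvg0 (R : realType) (f V : R -> R) :
  (forall t, f t ^+ 2 <= V t) -> V t @[t --> +oo] --> (0 : R) ->
  f t @[t --> +oo] --> (0 : R).
Proof.
move=> fV V0; apply/cvgrPdist_lt => e e0.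
have /cvgrPdist_lt/(_ (e ^+ 2)) := V0; rewrite exprn_gt0 // => /(_ isT).
apply: filterS => t; rewrite !sub0r !normrN => Ve.
rewrite -(ltr_pXn2r (ltn0Sn 1)) ?nnegrE ?(ltW e0) // real_normK ?num_real //.
exact/(le_lt_trans (fV t))/(le_lt_trans (ler_norm _)).
Qed.

(** Energy estimate for [V = |f|^2]: its rate is [- 2 c V] plus a cross term, and Young's inequality
    bounds the latter by [c V + |u|^2 / c]. *)
Lemma scalar_vanish (R : realType) (f u : R -> R[i]) (a : R[i]) :
  complex.Re a < 0 -> cderive f (fun t => a * f t + u t) -> vanish u -> vanish f.
Proof.
move=> a0 df [u1 u2]; pose c := - complex.Re a.
have c0 : 0 < c by rewrite oppr_gt0.
pose V t := complex.Re (f t) ^+ 2 + complex.Im (f t) ^+ 2.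
pose d t := (complex.Re (u t) ^+ 2 + complex.Im (u t) ^+ 2) / c.
pose V' t := 2 * (complex.Re (f t) * complex.Re (a * f t + u t) +
                  complex.Im (f t) * complex.Im (a * f t + u t)).
have V0 : V t @[t --> +oo] --> (0 : R).
  apply: (@decay R V V' d c c0) => [t t0|t t0|t t0|].
  - have [h1 h2] := df t t0; rewrite /V /V'.
    by apply: is_derive_eq; rewrite /GRing.scale /=; ring.
  - by rewrite addr_ge0 ?sqr_ge0.
  - rewrite /V' /V /d !(ReD, ImD, ReM, ImM).
    move: (complex.Re (f t)) (complex.Im (f t)) (complex.Re (u t)) (complex.Im (u t)).
    move=> x y p q.
    have ca : complex.Re a = - c by rewrite opprK.
    have hx : 2 * (x * p) <= c * x ^+ 2 + p ^+ 2 / c.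
      rewrite -subr_ge0 (_ : _ - _ = (c * x - p) ^+ 2 / c); last by field; lra.
      by rewrite divr_ge0 ?sqr_ge0 // ltW.
    have hy : 2 * (y * q) <= c * y ^+ 2 + q ^+ 2 / c.
      rewrite -subr_ge0 (_ : _ - _ = (c * y - q) ^+ 2 / c); last by field; lra.
      by rewrite divr_ge0 ?sqr_ge0 // ltW.
    rewrite ca mulrDl; lra.
  - have h := cvgMr_tmp (b := c^-1) (cvgD (cvgM u1 u1) (cvgM u2 u2)).
    by rewrite mulr0 addr0 mul0r in h; exact: h.
split; apply: sqr_cvg0 V0 => t; rewrite /V ?lerDl ?lerDr sqr_ge0 //.
Qed.

(** Stands in for generalized eigenvectors: modes are removed one factor at a time, starting from
    the row that the full product produces. *)
Lemma annihilated_induction (F : fieldType) n (M : 'M[F]_n.+1)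
    (W : 'rV[F]_n.+1 -> Prop) (rs : seq F) :
  (forall z w, z \in rs -> W (w *m (M - z%:M)) -> W w) ->
  forall w, W (w *m \prod_(z <- rs) (M - z%:M)) -> W w.
Proof.
elim: rs => [|z rs IH] hW w; first by rewrite big_nil mulmx1.
rewrite big_cons mulmxA => /(IH _) h; apply: (hW z); first exact: mem_head.
by apply: h => z' w' z'rs; apply: hW; rewrite inE z'rs orbT.
Qed.

Lemma char_poly_factor (F : closedFieldType) n (M : 'M[F]_n.+1) :
  exists rs : seq F, (forall z, (z \in rs) = eigenvalue M z) /\
    \prod_(z <- rs) (M - z%:M) = 0.
Proof.
have [rs e] := closed_field_poly_normal (char_poly M).
move: e; rewrite (eqP (char_poly_monic M)) scale1r => e; exists rs; split=> [z|].
  by rewrite eigenvalue_root_char e root_prod_XsubC.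
have := Cayley_Hamilton M; rewrite e rmorph_prod /= => <-.
apply: eq_bigr => z _.
by rewrite rmorphB /= horner_mx_X horner_mx_C.
Qed.

(** For a row [w], the scalar [w *m xi] has rate [z] and forcing [w *m (F - z%:M) *m xi + w *m u].
    Thus decay passes back through each factor of the characteristic polynomial. *)
Lemma hurwitz_vanish (R : realType) n (F : 'M[R[i]]_n.+1)
    (xi u : R -> 'cV[R[i]]_n.+1) :
  hurwitzC F ->
  (forall k, cderive (fun t => xi t k 0) (fun t => (F *m xi t + u t) k 0)) ->
  (forall k, vanish (fun t => u t k 0)) ->
  forall k, vanish (fun t => xi t k 0).
Proof.
move=> hF dxi vu k.
have [rs [rsE rs0]] := char_poly_factor F.
have lin (w : 'rV[R[i]]_n.+1) (y : 'cV[R[i]]_n.+1) :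
  (w *m y) 0 0 = \sum_j w 0 j * y j 0 by rewrite mxE.
pose W (w : 'rV[R[i]]_n.+1) := vanish (fun t => (w *m xi t) 0 0).
suff : W (delta_mx 0 k) by apply: eq_vanish => t; rewrite -rowE mxE.
apply: (annihilated_induction (M := F) (rs := rs)); last first.
  by rewrite rs0 mulmx0; apply: eq_vanish (@vanish0 R) => t; rewrite mul0mx mxE.
move=> z w; rewrite rsE => /hF; rewrite addcJ_lt0 => z0 hW.
apply: (@scalar_vanish _ _ (fun t => (w *m (F - z%:M) *m xi t) 0 0 +
  (w *m u t) 0 0) z z0).
  apply: cderive_eq (cderive_sum (fun j => cderiveM (w 0 j) (dxi j))) => t.
    by rewrite lin.
  rewrite -lin mulmxDr mulmxBr mulmxBl mulmxA mul_mx_scalar -scalemxAl !mxE.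
  by rewrite addrA addrCA subrr addr0.
apply: vanishD => //.
by apply: eq_vanish (vanish_sum (fun j => vanishM (w 0 j) (vu j))) => t; rewrite lin.
Qed.

Lemma is_derive_coord (R : realType) m n (M : R -> 'M[R]_(m, n)) (t : R) dM i j :
  is_derive t (1 : R) M dM -> is_derive t (1 : R) (fun s => M s i j) (dM i j).
Proof.
case=> dMt <-; have /derivable_mxP/(_ i j) h := dMt.
by apply: DeriveDef => //; rewrite derive_mx // mxE.
Qed.

Lemma interconnection_row_sum (R : realType) p (G : 'M[R]_p) i :
  is_interconnection G -> \sum_j G i j = 0.
Proof. by case=> _ h; rewrite (bigD1 i) //= h addNr. Qed.

Lemma interconnection_input (R : realType) n m p (C : 'M[R]_(m, n))
    (L : 'M[R]_(n, m)) (G : 'M[R]_p) (x : 'I_p -> 'cV[R]_n) i :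
  is_interconnection G ->
  L *m (\sum_(j | j != i) G i j *: (C *m x j - C *m x i)) =
  (L *m C) *m \sum_j G i j *: x j.
Proof.
move=> hG; rewrite -mulmxA; congr (L *m _).
have -> : \sum_(j | j != i) G i j *: (C *m x j - C *m x i) =
    \sum_j G i j *: (C *m x j - C *m x i).
  by rewrite [RHS](bigD1 i) //= subrr scaler0 add0r.
under eq_bigr do rewrite scalerBr.
rewrite sumrB -scaler_suml interconnection_row_sum // scale0r subr0 mulmx_sumr.
by apply: eq_bigr => j _; rewrite scalemxAr.
Qed.

(* The weights [w] for which the combination of states vanishes are closed
   under cancelling a factor [G - l], for [l] a nonzero eigenvalue of [G]. *)
Lemma array_modes_vanish (R : realType) n p (A B : 'M[R]_n.+1) (G : 'M[R]_p.+1)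
    (x : 'I_p.+1 -> R -> 'cV[R]_n.+1) (w : 'rV[R]_p.+1) :
  (forall l, ceigenvalue G l -> l != 0 -> hurwitzC (cmx A + l *: cmx B)) ->
  (forall i (t : R), 0 < t ->
    is_derive t (1 : R) (x i) (A *m x i t + B *m \sum_j G i j *: x j t)) ->
  (forall k, exists v : 'rV[R]_p.+1, w = v *m G ^+ k) ->
  forall k, (\sum_i w 0 i * x i t k 0) @[t --> +oo] --> (0 : R).
Proof.
move=> hAB dx wG.
have [rs [rsE rs0]] := char_poly_factor (cmx G).
pose st (w : 'rV[R[i]]_p.+1) (t : R) : 'cV[R[i]]_n.+1 :=
  \sum_i w 0 i *: cmx (x i t).
have stE u t k : st u t k 0 = \sum_i u 0 i * (x i t k 0)%:C%C.
  by rewrite summxE; apply: eq_bigr => i _; rewrite !mxE.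
have stD u1 u2 t : st (u1 + u2) t = st u1 t + st u2 t.
  by rewrite /st -big_split; apply: eq_bigr => i _; rewrite !mxE scalerDl.
have stZ a u t : st (a *: u) t = a *: st u t.
  by rewrite /st scaler_sumr; apply: eq_bigr => i _; rewrite mxE scalerA.
have stG u t : st (u *m cmx G) t =
    \sum_i u 0 i *: cmx (\sum_j G i j *: x j t).
  rewrite /st; under eq_bigr do rewrite mxE scaler_suml.
  rewrite exchange_big; apply: eq_bigr => i _ /=.
  rewrite map_mx_sum scaler_sumr; apply: eq_bigr => j _.
  by rewrite map_mxZ !mxE scalerA.
have dst u k : cderive (fun t => st u t k 0)
    (fun t => (cmx A *m st u t + cmx B *m st (u *m cmx G) t) k 0).
  have dxc i := cderive_real (fun t t0 => is_derive_coord k 0 (dx i t t0)).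
  apply: cderive_eq (cderive_sum (fun i => cderiveM (u 0 i) (dxc i))) => t.
    by rewrite stE.
  rewrite stG /st !mulmx_sumr -big_split summxE; apply: eq_bigr => i _ /=.
  rewrite -!scalemxAr -scalerDr -!map_mxM -map_mxD [RHS]mxE.
  by congr (_ * _); rewrite [RHS]mxE.
pose W (u : 'rV[R[i]]_p.+1) := forall k, vanish (fun t => st u t k 0).
suff Ww : W (cmx w).
  move=> k; have [h _] := Ww k; move: h; apply: cvg_trans; apply: near_eq_cvg.
  apply: nearW => t; rewrite stE raddf_sum /=.
  by apply: eq_bigr => i _; rewrite !mxE -rmorphM.
pose rs1 := [seq z <- rs | z != 0].
apply: (annihilated_induction (W := W) (M := cmx G) (rs := rs1)).
  move=> z u; rewrite mem_filter rsE => /andP[z0 /hAB -/(_ z0) hz] Wu k.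
  apply: (hurwitz_vanish (u := fun t => cmx B *m st (u *m (cmx G - z%:M)) t)
     hz) k => k.
    apply: (cderive_eq (fun=> erefl) _ (dst u k)) => t.
    (* The part [z *: u] joins [A] to form the Hurwitz matrix [A + z B]; the rest is a forcing that
       already vanishes. *)
    have -> : u *m cmx G = z *: u + u *m (cmx G - z%:M).
      by rewrite mulmxBr mul_mx_scalar addrC subrK.
    rewrite stD stZ mulmxDl mulmxDr -scalemxAr -scalemxAl.
    by rewrite addrA.
  have h j := vanishM (cmx B k j) (Wu j).
  by apply: eq_vanish (vanish_sum h) => t; rewrite mxE.
(* The exponent is the multiplicity of the root 0, so this power of [G] restores the factors
   filtered out of [rs] and the full product is 0. *)
have [v ->] := wG (count (pred1 0) rs).
rewrite map_mxM rmorphXn /= -mulmxA.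
have -> : cmx G ^+ count (pred1 0) rs *m \prod_(z <- rs1) (cmx G - z%:M) = 0.
  rewrite mulmxE -[RHS]rs0; elim: (rs) {rs0 rsE} @rs1 => [|z s IH] /=.
    by rewrite !big_nil mulr1.
  rewrite big_cons -IH; have [->|z0] /= := eqVneq z 0.
    by rewrite add1n exprS -mulrA raddf0 subr0.
  rewrite add0n big_cons !mulrA; congr (_ * _).
  apply/commr_sym/commrX/commr_sym/commrB; first exact: commr_refl.
  exact: comm_mx_scalar.
move=> k; apply: eq_vanish (@vanish0 R) => t.
by rewrite stE big1 // => i _; rewrite mulmx0 mxE mul0r.
Qed.

(** * Interconnections *)

(** The Gershgorin disc of the row where [|v|] is largest has center [- d] and radius [d], so it
    meets the closed right half-plane at 0 only. *)
Lemma interconnection_eigenvalue (R : realType) p (G : 'M[R]_p) (l : R[i]) :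
  is_interconnection G -> ceigenvalue G l -> l != 0 -> complex.Re l < 0.
Proof.
move=> hG /eigenvalue_vector[v Gv v0] l0.
have [i0 vi0] : exists i, v i 0 != 0.
  by case/matrix0Pn: v0 => i [j]; rewrite ord1; exists i.
pose N (i : 'I_p) : R := complex.Re `|v i 0|.
have NE i : `|v i 0| = (N i)%:C%C by rewrite /N RRe_real ?normr_real.
pose i := [arg max_(i > i0) N i]%O.
have Nmax j : `|v j 0| <= `|v i 0|.
  rewrite !NE lecR /i; case: (arg_maxP (P := xpredT) (i0 := i0) N (erefl true)).
  by move=> k _; exact.
have vi : v i 0 != 0.
  by rewrite -normr_gt0 (lt_le_trans _ (Nmax i0)) // normr_gt0.
have [Goff Gdiag] := hG; pose d := \sum_(j | j != i) G i j.
have d0 : 0 <= d by apply: sumr_ge0 => j; rewrite eq_sym; exact: Goff.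
have e : (l + d%:C%C) * v i 0 = \sum_(j | j != i) (G i j)%:C%C * v j 0.
  have /matrixP/(_ i 0) := Gv; rewrite !mxE (bigD1 i) //= !mxE Gdiag -/d.
  under eq_bigr do rewrite mxE.
  by rewrite mulrDl => <-; rewrite rmorphN mulNr /= [X in X + _]addrC subrK.
have le : `|l + d%:C%C| <= d%:C%C.
  rewrite -(ler_pM2r (_ : 0 < `|v i 0|)) ?normr_gt0 // -normrM e.
  apply: le_trans (ler_norm_sum _ _ _) _.
  rewrite rmorph_sum mulr_suml; apply: ler_sum => j ji; rewrite normrM.
  have Gij : 0 <= (G i j)%:C%C :> R[i] by rewrite ler0c Goff // eq_sym.
  by rewrite ger0_norm // ler_wpM2l.
rewrite ltNge; apply: contra l0 => Re0.
have : (`|l + d%:C%C| ^+ 2 <= (d%:C%C) ^+ 2)%R.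
  by rewrite lerXn2r // ?nnegrE ?normr_ge0 // ler0c.
rewrite -add_Re2_Im2 ReD ImD /= addr0 -rmorphXn lecR => h.
have := sqr_ge0 (complex.Im l); have := sqr_ge0 (complex.Re l) => h1 h2.
have h3 : 0 <= complex.Re l * d by rewrite mulr_ge0.
have hs : complex.Re l ^+ 2 + 2 * (complex.Re l * d) + complex.Im l ^+ 2 <= 0.
  by move: h; rewrite sqrrD -mulr_natl; lra.
have e1 : complex.Re l ^+ 2 = 0 by lra.
have e2 : complex.Im l ^+ 2 = 0 by lra.
move/eqP: e1; move/eqP: e2; rewrite !sqrf_eq0 => /eqP e2 /eqP e1.
by rewrite eq_complex /= e1 e2 !eqxx.
Qed.

(** At a node where [v] is largest, every term [G i j * (v j 0 - v i 0)] is nonpositive. *)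
Lemma interconnection_const_le0 (R : realType) p (G : 'M[R]_p) (v : 'cV_p) c :
  is_interconnection G -> (0 < p)%N -> (forall i, (G *m v) i 0 = c) -> c <= 0.
Proof.
move=> hG p0 Gv; pose i0 := Ordinal p0.
case: (arg_maxP (P := xpredT) (i0 := i0) (fun i => v i 0) (erefl true)) => i _ vmax.
have -> : c = \sum_j G i j * (v j 0 - v i 0).
  under eq_bigr do rewrite mulrBr.
  by rewrite sumrB -mulr_suml interconnection_row_sum // mul0r subr0 -(Gv i) mxE.
apply: sumr_le0 => j _; have [->|ji] := eqVneq j i; first by rewrite subrr mulr0.
apply: mulr_ge0_le0; last by rewrite subr_le0; exact: vmax.
by apply: hG.1; rewrite eq_sym.
Qed.

(* Maximum principle: the maximum propagates along the edges up to the root. *)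
Lemma interconnection_max (R : realType) p (G : 'M[R]_p) (v : 'cV_p) r :
  is_interconnection G -> (forall i, i != r -> connect (graph_edge G) i r) ->
  G *m v = 0 -> forall j, v j 0 <= v r 0.
Proof.
move=> hG hr Gv j.
case: (arg_maxP (P := xpredT) (i0 := r) (fun i => v i 0) (erefl true)) => i _ vmax.
suff -> : v r 0 = v i 0 by exact: vmax.
have step a b : v a 0 = v i 0 -> graph_edge G a b -> v b 0 = v i 0.
  move=> va Gab.
  have h : \sum_k G a k * (v i 0 - v k 0) = 0.
    under eq_bigr do rewrite mulrBr.
    rewrite sumrB -mulr_suml interconnection_row_sum // mul0r sub0r.
    by have /matrixP/(_ a 0) := Gv; rewrite !mxE => ->; rewrite oppr0.
  have pos k : xpredT k -> 0 <= G a k * (v i 0 - v k 0).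
    have [->|ka] := eqVneq k a; first by rewrite va subrr mulr0.
    move=> _; apply: mulr_ge0; last by rewrite subr_ge0; exact: vmax.
    by apply: hG.1; rewrite eq_sym.
  have := psumr_eq0P pos h (erefl : xpredT b).
  by move/eqP; rewrite mulf_eq0 gt_eqF //= subr_eq0 => /eqP.
have [->//|ir] := eqVneq i r.
have /connectP[s ps ->] := hr i ir.
have walk a : v a 0 = v i 0 -> path (graph_edge G) a s -> v (last a s) 0 = v i 0.
  elim: s {ps} a => [|b s IH] a //= va /andP[ab]; apply: IH.
  exact: (step a).
exact: walk.
Qed.

(** Applied to [v] and [- v], the sign bound gives [c = 0] and the maximum principle gives equality.
    Allowing a constant [c] is what drives the induction on powers of [G]. *)
Lemma interconnection_kernel (R : realType) p (G : 'M[R]_p) (v : 'cV_p) c :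
  is_interconnection G -> connected_digraph (graph_edge G) ->
  (forall i, (G *m v) i 0 = c) -> forall i j, v i 0 = v j 0.
Proof.
move=> hG [r hr] Gv; have p0 : (0 < p)%N := leq_ltn_trans (leq0n r) (ltn_ord r).
have GvN i : (G *m - v) i 0 = - c by rewrite mulmxN mxE Gv.
have c0 : c = 0.
  apply/eqP; rewrite eq_le (interconnection_const_le0 hG p0 Gv).
  by rewrite -oppr_le0 (interconnection_const_le0 hG p0 GvN).
have Gv0 : G *m v = 0 by apply/matrixP => i j; rewrite ord1 Gv c0 mxE.
have GvN0 : G *m - v = 0 by rewrite mulmxN Gv0 oppr0.
suff h i : v i 0 = v r 0 by move=> i j; rewrite !h.
apply/eqP; rewrite eq_le (interconnection_max hG hr Gv0).
by have := interconnection_max hG hr GvN0 i; rewrite !mxE lerN2.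
Qed.

Lemma interconnection_exp_kernel (R : realType) p (G : 'M[R]_p) (v : 'cV_p) k :
  is_interconnection G -> connected_digraph (graph_edge G) ->
  G ^+ k *m v = 0 -> forall i j, v i 0 = v j 0.
Proof.
move=> hG cG; elim: k v => [|k IH] v.
  by rewrite expr0 mul1mx => -> i j; rewrite !mxE.
rewrite exprSr -mulmxA => /IH h i j.
exact: (interconnection_kernel hG cG (c := (G *m v) i 0)).
Qed.

(** Membership in the row space is tested on the cokernel, whose columns lie in the kernel of
    [G ^+ k] and are therefore constant. *)
Lemma interconnection_exp_image (R : realType) p (G : 'M[R]_p) (w : 'rV_p) k :
  is_interconnection G -> connected_digraph (graph_edge G) ->
  \sum_i w 0 i = 0 -> exists v, w = v *m G ^+ k.
Proof.
move=> hG cG w0; apply/submxP; rewrite submxE; apply/eqP/matrixP => a b.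
rewrite ord1 !mxE; have [r _] := cG.
have K i : cokermx (G ^+ k) i b = cokermx (G ^+ k) r b.
  have := @interconnection_exp_kernel _ _ G (col b (cokermx (G ^+ k))) k hG cG _ i r.
  by rewrite !mxE; apply; rewrite colE mulmxA mulmx_coker mul0mx.
under eq_bigr do rewrite K.
by rewrite -mulr_suml w0 mul0r.
Qed.

Lemma mxnorm_cvg0 (R : realType) m n (M : R -> 'M[R]_(m, n)) :
  (forall i j, M t i j @[t --> +oo] --> (0 : R)) ->
  `|M t| @[t --> +oo] --> (0 : R).
Proof.
move=> h; apply/cvgrPdist_le => e e0; near=> t.
rewrite sub0r normrN normr_id [in leLHS]/Num.Def.normr/= mx_normrE.
rewrite (bigmax_le _ (ltW e0))//= => -[i j] _ /=.
move: i j; near: t; apply: filter_forall => i; apply: filter_forall => j.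
have /cvgrPdist_le/(_ _ e0) := h i j.
by apply: filterS => t; rewrite sub0r normrN.
Unshelve. all: by end_near. Qed.

Lemma hurwitz_modes_synchronize (R : realType) n m p (A : 'M[R]_n.+1)
    (C : 'M[R]_(m.+1, n.+1)) (L : 'M[R]_(n.+1, m.+1)) (G : 'M[R]_p)
    (x : 'I_p -> R -> 'cV[R]_n.+1) :
  is_interconnection G -> connected_digraph (graph_edge G) ->
  (forall l, ceigenvalue G l -> l != 0 ->
     hurwitzC (cmx A + l *: cmx (L *m C))) ->
  array_solution A C L G x -> synchronize x.
Proof.
case: p => [|p] in G x * => hG cG hL sol; first by exists (fun=> 0); case.
(* Every node is compared with node 0, through the zero-sum weight [w]. *)
exists (x ord0) => i; apply: mxnorm_cvg0 => a b; rewrite ord1.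
pose w : 'rV[R]_p.+1 := delta_mx 0 i - delta_mx 0 ord0.
have sw (f : 'I_p.+1 -> R) : \sum_j w 0 j * f j = f i - f ord0.
  under eq_bigr do rewrite !mxE eqxx /= mulrBl.
  rewrite sumrB (bigD1 i) // [X in _ - X](bigD1 ord0) //= !eqxx !mul1r.
  rewrite !big1 ?addr0 // => j /negPf ->; exact: mul0r.
have wG k : exists v : 'rV[R]_p.+1, w = v *m G ^+ k.
  apply: interconnection_exp_image => //.
  by have := sw (fun=> 1); under eq_bigr do rewrite mulr1; rewrite subrr.
have dx j (t : R) : 0 < t -> is_derive t (1 : R) (x j)
    (A *m x j t + (L *m C) *m \sum_k G j k *: x k t).
  by move=> t0; have [_ /(_ t t0)] := sol j; rewrite interconnection_input.
have := array_modes_vanish hL dx wG a; apply: cvg_trans; apply: near_eq_cvg.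
by apply: nearW => t; rewrite sw !mxE.
Qed.

Lemma seq_argmin (T : eqType) (R : realDomainType) (f : T -> R) (s : seq T) x :
  x \in s -> exists2 y, y \in s & forall z, z \in s -> f y <= f z.
Proof.
elim: s x => [|a s IH] x; first by rewrite in_nil.
move=> _; case: s IH => [|b s] IH.
  by exists a => [|z]; rewrite ?mem_head // mem_seq1 => /eqP ->.
have [y ys ymin] := IH b (mem_head _ _).
have [ay|ya] := leP (f a) (f y).
  exists a => [|z]; rewrite ?mem_head // inE => /predU1P[-> //|/ymin].
  exact: le_trans.
exists y => [|z]; first by rewrite inE ys orbT.
by rewrite inE => /predU1P[->|/ymin //]; exact: ltW.
Qed.

(** The spectrum is finite, so once a nonzero eigenvalue exists, one closest to the imaginary axis
    exists too and the hypothesis applies to it. *)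
Lemma lambda2_bound (R : realType) p (G : 'M[R]_p) (d : R) (l : R[i]) :
  (forall l, is_lambda2 G l -> d <= `|complex.Re l|) ->
  ceigenvalue G l -> l != 0 -> d <= `|complex.Re l|.
Proof.
case: p G => [|p] G hd lG l0.
  by move: lG => /eigenvalueP[v _]; rewrite [v]thinmx0 eqxx.
have [rs [rsE _]] := char_poly_factor (cmx G).
have [|y] := @seq_argmin _ _ (fun z => `|complex.Re z|) [seq z <- rs | z != 0] l.
  by rewrite mem_filter l0 rsE; exact: lG.
rewrite mem_filter rsE => /andP[y0 yG] ymin.
have nz z : ceigenvalue G z -> z != 0 -> `|complex.Re y| <= `|complex.Re z|.
  by move=> zG z0; apply: ymin; rewrite mem_filter z0 rsE; exact: zG.
apply: le_trans (nz l lG l0).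
by apply: hd; split; [exact: yG | exact: y0 | exact: nz].
Qed.

(** * The matrix exponential and detectability *)

Lemma mx_cvg (R : realType) (T : Type) (F : set_system T) (FF : Filter F) m n
    (M : T -> 'M[R]_(m, n)) (l : 'M[R]_(m, n)) :
  (forall i j, M t i j @[t --> F] --> l i j) -> M t @[t --> F] --> l.
Proof.
move=> h; apply/cvgrPdist_le => e e0; near=> t.
rewrite [in leLHS]/Num.Def.normr/= mx_normrE.
rewrite (bigmax_le _ (ltW e0))//= => -[i j] _ /=; rewrite !mxE.
move: i j; near: t; apply: filter_forall => i; apply: filter_forall => j.
exact: (cvgrPdist_le _ _).1 (h i j) e e0.
Unshelve. all: by end_near. Qed.

Lemma cvg_bigsum (R : realType) (T : Type) (F : set_system T) (FF : Filter F)
    (I : Type) (s : seq I) (f : I -> T -> R) (l : I -> R) :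
  (forall i, f i t @[t --> F] --> l i) ->
  \sum_(i <- s) f i t @[t --> F] --> \sum_(i <- s) l i.
Proof.
move=> h; elim: s => [|i s IH].
  by under eq_fun do rewrite big_nil; rewrite big_nil; exact: cvg_cst.
under eq_fun do rewrite big_cons; rewrite big_cons; exact: cvgD.
Qed.

(** Power series coefficients in [t] of an entry of [C *m expmx (t *: A) *m B], which give access to
    scalar power series. *)
Definition exp_entry (R : realType) m n q (C : 'M[R]_(m, n)) (A : 'M[R]_n)
    (B : 'M[R]_(n, q)) i j (k : nat) : R :=
  (k`!%:R)^-1 * (C *m A ^+ k *m B) i j.

Lemma expmx_entry_bound (R : realType) n (A : 'M[R]_n) k i j :
  `|(A ^+ k) i j| <= (\sum_i \sum_j `|A i j|) ^+ k.
Proof.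
elim: k i j => [|k IH] i j.
  by rewrite !expr0 mxE; case: (i == j); rewrite ?normr1 ?normr0.
rewrite !exprS mxE (le_trans (ler_norm_sum _ _ _)) //.
apply: (@le_trans _ _ (\sum_l `|A i l| * (\sum_i \sum_j `|A i j|) ^+ k)).
  by apply: ler_sum => l _; rewrite normrM ler_wpM2l.
rewrite -mulr_suml ler_wpM2r ?exprn_ge0 ?sumr_ge0 //.
  by move=> a _; rewrite sumr_ge0.
by rewrite [leRHS](bigD1 i) //= lerDl sumr_ge0 // => a _; rewrite sumr_ge0.
Qed.

Lemma is_cvg_exp_entry1 (R : realType) n (A : 'M[R]_n) i j (t : R) :
  cvgn (pseries (exp_entry 1%:M A 1%:M i j) t).
Proof.
apply: normed_cvg; pose N := \sum_i \sum_j `|A i j|.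
have N0 : 0 <= N by rewrite sumr_ge0 // => a _; rewrite sumr_ge0.
apply: (series_le_cvg _ _ _ (is_cvg_series_exp_coeff (N * `|t|))) => k /=.
- exact: normr_ge0.
- by rewrite exp_coeff_ge0 // mulr_ge0.
rewrite /exp_entry mul1mx mulmx1 !normrM normrX ger0_norm ?invr_ge0 ?ler0n //.
rewrite /exp_coeff /= exprMn [leRHS]mulrC -mulrA ler_wpM2l ?invr_ge0 ?ler0n //.
by rewrite ler_wpM2r ?exprn_ge0 // expmx_entry_bound.
Qed.

Lemma exprZ_mx (R : comPzRingType) n (A : 'M[R]_n) (t : R) k :
  (t *: A) ^+ k = t ^+ k *: A ^+ k.
Proof.
elim: k => [|k IH]; first by rewrite !expr0 scale1r.
by rewrite !exprS IH -!mulmxE -scalemxAl -scalemxAr scalerA.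
Qed.

(** [expmx] is a [lim], hence meaningful only once convergence is known; the entrywise limits supply
    it. *)
Lemma expmx_cvg (R : realType) n (A : 'M[R]_n) (t : R) :
  series (fun k : nat => (k`!%:R)^-1 *: (t *: A) ^+ k) @ \oo --> expmx (t *: A).
Proof.
suff : cvgn (series (fun k : nat => (k`!%:R)^-1 *: (t *: A) ^+ k)) by [].
apply/cvg_ex; exists (\matrix_(i, j) limn (pseries (exp_entry 1%:M A 1%:M i j) t)).
apply: mx_cvg => i j; rewrite mxE.
have := @is_cvg_exp_entry1 R n A i j t; apply: cvg_trans; apply: near_eq_cvg.
apply: nearW => N; rewrite /pseries /series /= summxE.
apply: eq_bigr => k _; rewrite /exp_entry mul1mx mulmx1 exprZ_mx !mxE.
by rewrite -mulrA; congr (_ * _); rewrite mulrC.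
Qed.

Lemma expmx_entry (R : realType) m n q (C : 'M[R]_(m, n)) (A : 'M[R]_n)
    (B : 'M[R]_(n, q)) i j (t : R) :
  pseries (exp_entry C A B i j) t @ \oo --> (C *m expmx (t *: A) *m B) i j.
Proof.
have h a b : (series (fun k : nat => (k`!%:R)^-1 *: (t *: A) ^+ k) N) a b
    @[N --> \oo] --> expmx (t *: A) a b.
  exact: cvg_comp (@expmx_cvg R n A t) (@coord_continuous _ _ _ a b _).
have : \sum_b (\sum_a C i a * series (fun k : nat => (k`!%:R)^-1 *:
     (t *: A) ^+ k) N a b) * B b j @[N --> \oo] -->
     \sum_b (\sum_a C i a * expmx (t *: A) a b) * B b j.
  apply: cvg_bigsum => b; apply: cvgMr_tmp; apply: cvg_bigsum => a.
  exact: cvgMl_tmp.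
have -> : (C *m expmx (t *: A) *m B) i j =
    \sum_b (\sum_a C i a * expmx (t *: A) a b) * B b j.
  by rewrite mxE; apply: eq_bigr => b _; rewrite mxE.
apply: cvg_trans; apply: near_eq_cvg; apply: nearW => N.
transitivity ((C *m series (fun k : nat => (k`!%:R)^-1 *: (t *: A) ^+ k) N *m B) i j).
  by rewrite mxE; apply: eq_bigr => b _; rewrite mxE.
rewrite /series /= mulmx_sumr mulmx_suml summxE; apply: eq_bigr => k _.
by rewrite exprZ_mx -!scalemxAr -!scalemxAl scalerA [LHS]mxE mulrAC.
Qed.

(** Differentiating the power series shifts its coefficients, which amounts to inserting one more
    factor [A] before [B]. *)
Lemma is_derive_expmx (R : realType) n q (A : 'M[R]_n) (B : 'M[R]_(n, q)) i j
    (t : R) :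
  is_derive t (1 : R) (fun s => (expmx (s *: A) *m B) i j)
    ((expmx (t *: A) *m (A *m B)) i j).
Proof.
have E (D : 'M[R]_(n, q)) s :
    (expmx (s *: A) *m D) i j = limn (pseries (exp_entry 1%:M A D i j) s).
  by rewrite -[in LHS](mul1mx (expmx _)); apply/esym/cvg_lim => //; exact: expmx_entry.
have cv (D : 'M[R]_(n, q)) s : cvgn (pseries (exp_entry 1%:M A D i j) s).
  by apply/cvg_ex; exists ((1%:M *m expmx (s *: A) *m D) i j); exact: expmx_entry.
have dif (D : 'M[R]_(n, q)) :
    pseries_diffs (exp_entry 1%:M A D i j) = exp_entry 1%:M A (A *m D) i j.
  apply/funext => k; rewrite /pseries_diffs /exp_entry factS natrM invfM.
  by rewrite mulrA mulVKf ?pnatr_eq0 // exprSr !mul1mx mulmxA.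
under eq_fun do rewrite E; rewrite E -dif.
apply: (@pseries_snd_diffs _ _ (`|t| + 1)); rewrite ?dif //.
by rewrite [ltRHS]ger0_norm ?ltrDl // addr_ge0.
Qed.

Lemma expmx0_mul (R : realType) n q (A : 'M[R]_n) (B : 'M[R]_(n, q)) :
  expmx (0 *: A) *m B = B.
Proof.
apply/matrixP => i j; have := @expmx_entry _ _ _ _ 1%:M A B i j 0.
rewrite mul1mx => /cvg_lim <- //; apply: lim_near_cst => //.
exists 1%N => // -[|N] //= _; rewrite /pseries /series /= big_nat_recl //= big1.
  by rewrite addr0 expr0 mulr1 /exp_entry expr0 fact0 invr1 !mul1mx mul1r.
by move=> k _; rewrite exprS mul0r mulr0.
Qed.

Lemma Re_mulmx (R : rcfType) m n q (M : 'M[R]_(m, n)) (v : 'M[R[i]]_(n, q)) :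
  map_mx (@complex.Re R) (cmx M *m v) = M *m map_mx (@complex.Re R) v.
Proof.
apply/matrixP => i j; rewrite !mxE raddf_sum; apply: eq_bigr => k _.
by rewrite /= !mxE ReM /= mul0r subr0.
Qed.

Lemma Im_mulmx (R : rcfType) m n q (M : 'M[R]_(m, n)) (v : 'M[R[i]]_(n, q)) :
  map_mx (@complex.Im R) (cmx M *m v) = M *m map_mx (@complex.Im R) v.
Proof.
apply/matrixP => i j; rewrite !mxE raddf_sum; apply: eq_bigr => k _.
by rewrite /= !mxE ImM /= mul0r addr0.
Qed.

(* An undetected mode [v] with [Re a >= 0] yields the solution
   [phi + i psi = expmx (t A) v], whose energy [V] satisfies [V' = 2 Re a V]
   and so does not decay. *)
Lemma detectable_hautus (R : realType) n m (A : 'M[R]_n) (H : 'M[R]_(m, n)) :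
  detectable H A -> hautus A H.
Proof.
move=> det a v Av Hv v0; rewrite addcJ_lt0 ltNge; apply/negP => a0.
pose x := map_mx (@complex.Re R) v; pose y := map_mx (@complex.Im R) v.
have Ax : A *m x = complex.Re a *: x - complex.Im a *: y.
  by rewrite -Re_mulmx Av; apply/matrixP => i j; rewrite !mxE ReM.
have Ay : A *m y = complex.Re a *: y + complex.Im a *: x.
  by rewrite -Im_mulmx Av; apply/matrixP => i j; rewrite !mxE ImM.
have HAv k : cmx (H *m A ^+ k) *m v = 0.
  rewrite map_mxM -mulmxA; have -> : cmx (A ^+ k) *m v = a ^+ k *: v.
    elim: k => [|k IH]; first by rewrite !expr0 map_mx1 mul1mx scale1r.
    by rewrite exprSr map_mxM -mulmxA Av -scalemxAr IH scalerA -exprS.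
  by rewrite -scalemxAr Hv scaler0.
have unobs (z : 'cV[R]_n) : (forall k, H *m A ^+ k *m z = 0) ->
    forall i, (expmx (t *: A) *m z) i 0 @[t --> +oo] --> (0 : R).
  move=> Hz i; have h : expmx (t *: A) *m z @[t --> +oo] --> (0 : 'cV[R]_n).
    apply: det => t _; apply/matrixP => b c.
    have := @expmx_entry _ _ _ _ H A z b c t => /cvg_lim <- //.
    rewrite [RHS]mxE; apply: lim_near_cst => //; apply: nearW => N.
    rewrite /pseries /series /= big1 // => k _.
    by rewrite /exp_entry Hz mxE mulr0 mul0r.
  have := cvg_comp _ _ h (@coord_continuous _ _ _ i 0 (0 : 'cV[R]_n)).
  by rewrite mxE.
have Hx k : H *m A ^+ k *m x = 0.
  by rewrite -Re_mulmx HAv; apply/matrixP => i j; rewrite !mxE.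
have Hy k : H *m A ^+ k *m y = 0.
  by rewrite -Im_mulmx HAv; apply/matrixP => i j; rewrite !mxE.
have hx := unobs x Hx; have hy := unobs y Hy.
pose f i (t : R) := (expmx (t *: A) *m x) i 0.
pose g i (t : R) := (expmx (t *: A) *m y) i 0.
pose V (t : R) := \sum_i (f i t ^+ 2 + g i t ^+ 2).
have df i (t : R) : is_derive t (1 : R) (f i)
    (complex.Re a * f i t - complex.Im a * g i t).
  have -> : complex.Re a * f i t - complex.Im a * g i t =
      (expmx (t *: A) *m (A *m x)) i 0.
    rewrite Ax mulmxBr -!scalemxAr /f /g.
    by move: (_ *m x) (_ *m y) => X Y; rewrite !mxE.
  exact: is_derive_expmx.
have dg i (t : R) : is_derive t (1 : R) (g i)
    (complex.Re a * g i t + complex.Im a * f i t).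
  have -> : complex.Re a * g i t + complex.Im a * f i t =
      (expmx (t *: A) *m (A *m y)) i 0.
    rewrite Ay mulmxDr -!scalemxAr /f /g.
    by move: (_ *m x) (_ *m y) => X Y; rewrite !mxE.
  exact: is_derive_expmx.
have dV (t : R) : is_derive t (1 : R) V (2 * complex.Re a * V t).
  have VE : V = \sum_i (fun s => f i s ^+ 2 + g i s ^+ 2).
    by apply/funext => s; rewrite fct_sumE.
  rewrite [X in is_derive _ _ X]VE /V mulr_sumr; apply: is_derive_sum => i.
  have dfi := df i t; have dgi := dg i t.
  by apply: is_derive_eq; rewrite /GRing.scale /=; ring.
have V_ge0 t : 0 <= V t by apply: sumr_ge0 => i _; rewrite addr_ge0 ?sqr_ge0.
(* [derive_le0_le] works on an open half-line; starting it at -1 lets the time 0 be included. *)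
have dVN (t : R) : -1 < t ->
    is_derive t (1 : R) (fun s => - V s) (- (2 * complex.Re a * V t)).
  by move=> _; exact: is_deriveN.
have Vinc (t : R) : 0 <= t -> V 0 <= V t.
  move=> t0; rewrite -lerN2; apply: (derive_le0_le dVN) t0; last by rewrite ltrN10.
  by move=> s _; rewrite oppr_le0 !mulr_ge0.
have V00 : 0 < V 0.
  rewrite lt_def V_ge0 andbT; apply: contra v0.
  rewrite psumr_eq0 => [/allP h|i _]; last by rewrite addr_ge0 ?sqr_ge0.
  apply/eqP/matrixP => i j; rewrite ord1 mxE.
  have := h i (mem_index_enum _).
  rewrite /= /f /g !expmx0_mul paddr_eq0 ?sqr_ge0 // !sqrf_eq0 !mxE.
  move=> /andP[/eqP e1 /eqP e2].
  by apply/eqP; rewrite eq_complex e1 e2 !eqxx.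
have : V t @[t --> +oo] --> \sum_(i < n) ((0 : R) * 0 + 0 * 0).
  by apply: cvg_bigsum => i; apply: cvgD; apply: cvgM; 
    [exact: hx | exact: hx | exact: hy | exact: hy].
rewrite big1 => [|i _]; last by rewrite !mulr0 addr0.
move=> /cvgrPdist_lt/(_ _ V00)[M [_ hM]].
pose t := Num.max M 0 + 1.
have : `|0 - V t| < V 0 by apply: hM; rewrite /t ltr_pwDr // le_max lexx.
rewrite sub0r normrN ger0_norm // ltNge Vinc //.
by rewrite /t addr_ge0 // le_max lexx orbT.
Qed.

(** * Circulant networks *)

Lemma is_derive_mx (R : realType) m n (M : R -> 'M[R]_(m, n)) (t : R)
    (dM : 'M[R]_(m, n)) :
  (forall i j, is_derive t (1 : R) (fun s => M s i j) (dM i j)) ->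
  is_derive t (1 : R) M dM.
Proof.
move=> h; have dMt : derivable M t 1.
  by apply/derivable_mxP => i j; have [] := h i j.
apply: DeriveDef => //; rewrite derive_mx //; apply/matrixP => i j.
by rewrite mxE; have [_] := h i j.
Qed.

Lemma array_solution_entries (R : realType) n m p (A : 'M[R]_n.+1)
    (C : 'M[R]_(m.+1, n.+1)) (L : 'M[R]_(n.+1, m.+1)) (G : 'M[R]_p)
    (x : 'I_p -> R -> 'cV[R]_n.+1) :
  is_interconnection G ->
  (forall i (t : R) k, is_derive t (1 : R) (fun s => x i s k 0)
     ((A *m x i t + (L *m C) *m \sum_j G i j *: x j t) k 0)) ->
  array_solution A C L G x.
Proof.
move=> hG dx y z u i.
have dxi (t : R) : is_derive t (1 : R) (x i)
    (A *m x i t + (L *m C) *m \sum_j G i j *: x j t).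
  by apply: is_derive_mx => k j; rewrite ord1.
split=> [|t _]; last by rewrite /u /z /y interconnection_input.
by apply: derivable_within_continuous => t _; have [] := dxi t.
Qed.

Lemma synchronize_cvg (R : realType) n p (x : 'I_p -> R -> 'cV[R]_n.+1) i j k :
  synchronize x -> x i t k 0 - x j t k 0 @[t --> +oo] --> (0 : R).
Proof.
move=> [xb hx]; apply/cvgrPdist_lt => e e0.
have e2 : 0 < e / 2 by rewrite divr_gt0.
have coord (M : 'cV[R]_n.+1) : `|M k 0| <= `|M|.
  rewrite [in leRHS]/Num.Def.normr /= mx_normrE.
  exact: (le_bigmax _ (fun ij => `|M ij.1 ij.2|) (k, 0)).
near=> t; rewrite sub0r normrN.
have hi : `|x i t - xb t| < e / 2.
  near: t; have /cvgrPdist_lt/(_ _ e2) := hx i.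
  by apply: filterS => t; rewrite sub0r normrN normr_id.
have hj : `|x j t - xb t| < e / 2.
  near: t; have /cvgrPdist_lt/(_ _ e2) := hx j.
  by apply: filterS => t; rewrite sub0r normrN normr_id.
have -> : x i t k 0 - x j t k 0 = (x i t - xb t) k 0 - (x j t - xb t) k 0.
  by rewrite !mxE; ring.
rewrite (le_lt_trans (ler_normB _ _)) // (splitr e).
by apply: ltrD; [exact: le_lt_trans hi | exact: le_lt_trans hj].
Unshelve. all: by end_near. Qed.

Lemma not_cvg0 (R : realType) (f : R -> R) :
  (forall t, 0 <= t -> 1 <= f t) -> ~ (f t @[t --> +oo] --> (0 : R)).
Proof.
move=> f1 /cvgrPdist_lt/(_ _ ltr01)[M [_ hM]].
pose t := Num.max M 0 + 1.
have t0 : 0 <= t by rewrite /t addr_ge0 // le_max lexx orbT.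
have : `|0 - f t| < 1 by apply: hM; rewrite /t ltr_pwDr // le_max lexx.
by rewrite sub0r normrN ltNge (le_trans (f1 t t0)) // ler_norm.
Qed.

(* Circulant interconnection of [p + 2] nodes, indexed by the ring ['I_p.+2] of
   integers modulo [p + 2]. *)
Definition circulant_graph (R : realType) p (g h : R) : 'M[R]_p.+2 :=
  \matrix_(i, j) (g * (j == i + 1)%:R + h * (j == i - 1)%:R
                  - (g + h) * (j == i)%:R).

Lemma sum_pick (R : pzRingType) (V : lmodType R) (I : finType) (a : I) (c : R)
    (f : I -> V) : \sum_j (c * (j == a)%:R) *: f j = c *: f a.
Proof.
rewrite (bigD1 a) //= eqxx mulr1 big1 ?addr0 // => j /negPf ->.
by rewrite mulr0 scale0r.
Qed.

Lemma circulant_sum (R : realType) p (g h : R) (V : lmodType R) i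
    (f : 'I_p.+2 -> V) :
  \sum_j circulant_graph p g h i j *: f j =
  g *: f (i + 1) + h *: f (i - 1) - (g + h) *: f i.
Proof.
under eq_bigr do rewrite mxE scalerBl scalerDl.
by rewrite sumrB big_split /= !sum_pick.
Qed.

Lemma circulant_interconnection (R : realType) p (g h : R) :
  0 <= g -> 0 <= h -> is_interconnection (circulant_graph p g h).
Proof.
move=> g0 h0; split=> [i j ij|i].
  rewrite mxE (eq_sym j i) (negPf ij) mulr0 subr0.
  by rewrite addr_ge0 // mulr_ge0 // ler0n.
have := circulant_sum g h i (fun=> 1 : R^o).
rewrite -!scalerDl subrr (bigD1 i) //= => /eqP.
rewrite addr_eq0 [_ *: _ in X in X == _]mulr1 => /eqP ->.
by congr (- _); apply: eq_bigr => j _; exact: mulr1.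
Qed.

Lemma circulant_connected (R : realType) p (g h : R) :
  0 < g -> 0 <= h -> connected_digraph (graph_edge (circulant_graph p g h)).
Proof.
move=> g0 h0; exists 0 => i _.
have edge j : graph_edge (circulant_graph p g h) j (j + 1).
  rewrite /graph_edge mxE eqxx mulr1.
  have -> : (j + 1 == j) = false.
    by rewrite -[X in _ == X]addr0 (inj_eq (addrI j)) oner_eq0.
  by rewrite mulr0 subr0 ltr_pwDl // mulr_ge0 // ler0n.
have walk k : connect (graph_edge (circulant_graph p g h)) i (i + k%:R).
  elim: k => [|k IH]; first by rewrite addr0 connect0.
  by rewrite mulrSr addrA; apply: connect_trans IH (connect1 (edge _)).
by have := walk (val (- i)); rewrite natr_Zp subrr.
Qed.

(** With two nodes, shifting twice is the identity, so [l * (v i 0 + v (i + 1) 0) = 0] and the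
    eigenvector is antisymmetric. *)
Lemma circulant2_eigenvalue (R : realType) (g : R) (l : R[i]) :
  ceigenvalue (circulant_graph 0 g 0) l -> l != 0 -> complex.Re l = - (2 * g).
Proof.
move=> /eigenvalue_vector[v Gv v0] l0.
have E i : l * v i 0 = (g%:C)%C * (v (i + 1) 0 - v i 0).
  have /matrixP/(_ i 0) := Gv; rewrite !mxE => <-.
  transitivity (\sum_j ((g%:C)%C * (j == i + 1)%:R - (g%:C)%C * (j == i)%:R) *
      v j 0).
    apply: eq_bigr => j _; rewrite !mxE mul0r !addr0; congr (_ * _).
    by rewrite rmorphB !rmorphM !rmorph_nat.
  under eq_bigr do rewrite mulrBl.
  by rewrite sumrB mulrBr; congr (_ - _); exact: (@sum_pick _ R[i]^o).
have i2 (i : 'I_2) : i + 1 + 1 = i.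
  by apply: val_inj; case: i => [[|[|[]]]].
have vN i : v (i + 1) 0 = - v i 0.
  apply/eqP; rewrite -addr_eq0 -(mulrI_eq0 _ (mulfI l0)) mulrDr !E i2.
  by rewrite -mulrDr addrC subrKA subrr mulr0.
have [i vi] : exists i, v i 0 != 0.
  by case/matrix0Pn: v0 => i [j]; rewrite ord1; exists i.
have -> : l = ((- (2 * g))%:C)%C.
  apply: (mulIf vi); rewrite E vN rmorphN rmorphM rmorph_nat /=.
  by ring.
by [].
Qed.

(** * Counterexamples *)

(** Nodes with states [X] and [- X] see the real coupling [- 2 g], and their difference [2 X] stays
    away from 0 in coordinate [k]. *)
Lemma circulant2_not_synchronize (R : realType) n m (A : 'M[R]_n.+1)
    (C : 'M[R]_(m.+1, n.+1)) (L : 'M[R]_(n.+1, m.+1)) (g : R)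
    (X : R -> 'cV[R]_n.+1) k :
  0 <= g ->
  (forall (t : R) k, is_derive t (1 : R) (fun s => X s k 0)
     ((A *m X t - (2 * g) *: ((L *m C) *m X t)) k 0)) ->
  (forall t, 0 <= t -> 1 <= X t k 0) ->
  exists2 x, array_solution A C L (circulant_graph 0 g 0) x & ~ synchronize x.
Proof.
move=> g0 dX X1; pose x (i : 'I_2) t := if i == 0 then X t else - X t.
have xS i t : x (i + 1) t = - x i t.
  by case: i => [[|[|[]]]] // ?; rewrite /x /= ?opprK.
have xP i t : x (i - 1) t = - x i t by rewrite -[i in RHS](subrK 1) xS opprK.
exists x.
  apply: array_solution_entries; first exact: circulant_interconnection.
  move=> i t j; rewrite circulant_sum xS addr0 scale0r addr0 scalerN -opprD.
  have -> : g *: x i t + g *: x i t = (2 * g) *: x i t by rewrite -scalerDl -mulr2n mulr_natl.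
  rewrite mulmxN -scalemxAr /x; case: ifP => _; first exact: dX.
  have -> : (A *m - X t - (2 * g) *: (L *m C *m - X t)) j 0 =
      - (A *m X t - (2 * g) *: (L *m C *m X t)) j 0.
    by rewrite !mulmxN scalerN -opprD mxE.
  by under eq_fun do rewrite mxE; apply: is_deriveN; exact: dX.
move=> sx; have := @synchronize_cvg _ _ _ x 0 1 k sx.
apply: (@not_cvg0 R (fun t => x 0 t k 0 - x 1 t k 0)) => t t0.
by rewrite /x /= mxE opprK (le_trans (X1 t t0)) // lerDl (le_trans _ (X1 t t0)).
Qed.

(** For [Z = X + i Y] the two equations say [Z' = A Z + mu L C Z] with
    [mu = - (g + h) - i (g - h)]. *)
Lemma circulant4_not_synchronize (R : realType) n m (A : 'M[R]_n.+1)
    (C : 'M[R]_(m.+1, n.+1)) (L : 'M[R]_(n.+1, m.+1)) (g h : R)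
    (X Y : R -> 'cV[R]_n.+1) k :
  0 <= g -> 0 <= h ->
  (forall (t : R) k, is_derive t (1 : R) (fun s => X s k 0)
     ((A *m X t + (L *m C) *m ((g - h) *: Y t - (g + h) *: X t)) k 0)) ->
  (forall (t : R) k, is_derive t (1 : R) (fun s => Y s k 0)
     ((A *m Y t + (L *m C) *m (- (g - h) *: X t - (g + h) *: Y t)) k 0)) ->
  (forall t, X t k 0 ^+ 2 + Y t k 0 ^+ 2 = 1) ->
  exists2 x, array_solution A C L (circulant_graph 2 g h) x & ~ synchronize x.
Proof.
move=> g0 h0 dX dY XY1.
pose x (i : 'I_4) t := nth 0 [:: X t; Y t; - X t; - Y t] i.
have xS2 i t : x (i + 1 + 1) t = - x i t.
  by case: i => [[|[|[|[|[]]]]]] // ?; rewrite /x /= ?opprK.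
have xP i t : x (i - 1) t = - x (i + 1) t.
  by rewrite -[i in RHS](subrK 1) xS2 opprK.
exists x.
  apply: array_solution_entries; first exact: circulant_interconnection.
  move=> i t j; rewrite circulant_sum xP scalerN -scalerBl.
  have dN (Z W : R -> 'cV[R]_n.+1) b : (is_derive t (1 : R) (fun s => Z s j 0)
      ((A *m Z t + (L *m C) *m (b *: W t - (g + h) *: Z t)) j 0)) ->
    is_derive t (1 : R) (fun s => (- Z s) j 0)
      ((A *m - Z t + (L *m C) *m (b *: - W t - (g + h) *: - Z t)) j 0).
    move=> dZ; have -> : (A *m - Z t + L *m C *m (b *: - W t - (g + h) *: - Z t)) j 0
       = - (A *m Z t + (L *m C) *m (b *: W t - (g + h) *: Z t)) j 0.
      by rewrite !scalerN -opprD !mulmxN -opprD mxE.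
    by under eq_fun do rewrite mxE; exact: is_deriveN.
  case: i => [[|[|[|[|[]]]]]] // ?; rewrite /x /=.
  - by have := dY t j; rewrite scaleNr -scalerN.
  - exact: dN (dX t j).
  - have := dN Y (fun t => - X t) (g - h); rewrite opprK; apply.
    by have := dY t j; rewrite scaleNr -scalerN.
move=> sx.
have hX := @synchronize_cvg _ _ _ x 0 (1 + 1) k sx.
have hY := @synchronize_cvg _ _ _ x 1 (1 + 1 + 1) k sx.
(* A single difference may pass through 0; the sum of the squared differences of both opposite pairs
   is constantly 4. *)
pose f t := (x 0 t k 0 - x (1 + 1) t k 0) * (x 0 t k 0 - x (1 + 1) t k 0) +
  (x 1 t k 0 - x (1 + 1 + 1) t k 0) * (x 1 t k 0 - x (1 + 1 + 1) t k 0).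
have hf : f t @[t --> +oo] --> ((0 : R) * 0 + 0 * 0).
  by apply: cvgD; apply: cvgM.
rewrite !mul0r addr0 in hf; apply: not_cvg0 hf => t t0.
rewrite /f /x /= !mxE !opprK.
have -> : (X t k 0 + X t k 0) * (X t k 0 + X t k 0) +
    (Y t k 0 + Y t k 0) * (Y t k 0 + Y t k 0) =
    4 * (X t k 0 ^+ 2 + Y t k 0 ^+ 2) by ring.
by rewrite XY1 mulr1 ler1n.
Qed.

Lemma nilpotent_no_unstable (R : realType) n (A : 'M[R]_n) :
  (forall l : R[i], ceigenvalue A l -> l = 0) -> no_unstable_eigenvalue A.
Proof. by move=> h l /h ->. Qed.

(** Two integrators without any edge ([g = 0]) stay at 1 and -1. *)
Lemma not_synchronizable_G_ge0 (R : realType) :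
  ~ (A_N R `&` O_F R `<=` synchronizable (G_ge0 R)).
Proof.
pose P : mxpair R := @MxPair R 0 0 1%:M 0.
move=> /(_ P)[|L syn].
  split; last by rewrite /O_F /= row_full_unit unitmx1.
  have n1 : (\sum_(i < 1) 1 = 1)%N by rewrite big_ord1.
  split.
    apply: nilpotent_no_unstable => l /eigenvalueP[v]; rewrite map_mx0 mulmx0.
    by move=> /esym/eqP; rewrite scaler_eq0 => /orP[/eqP //|/eqP ->]; rewrite eqxx.
  exists 1%N, (fun=> 1%N), (fun=> 0); split=> //; split=> //.
  (* The size [\sum_(i < 1) 1] is not convertible to 1, so constant matrices serve as the identity
     change of basis. *)
  exists (const_mx 1), (const_mx 1); split.
  - apply/matrixP => i j; rewrite !ord1 !mxE.
    rewrite (eq_bigr (fun=> 1)) => [|a _]; last by rewrite !mxE mulr1.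
    by rewrite sumr_const card_ord n1.
  - apply/matrixP => i j; rewrite !mxE big_ord1 !mxE mulr1.
    have s0 (a : 'I_(\sum_(i < 1) 1)%N) : a = 0%N :> nat.
      have : (a < 1)%N by rewrite (leq_trans (ltn_ord a)) // n1.
      by case: (nat_of_ord a).
    by have -> : i == j; first by rewrite -val_eqE /= !s0.
  - rewrite map_mx0; have -> : \mxdiag_(i < 1) jordan_block 1 (0 : R[i]) = 0.
      rewrite -mxdiag0; apply: eq_mxdiag => i; apply/matrixP => a b.
      by rewrite !ord1 !mxE /= mul0rn addr0.
    by rewrite mulmx0 mul0mx.
have [|||x sol] := @circulant2_not_synchronize R 0 0 0 1%:M L 0 (fun=> const_mx 1) 0.
- by [].
- move=> t k; rewrite mulr0 scale0r mul0mx subr0 !mxE; exact: is_derive_cst.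
- by move=> t _; rewrite mxE.
by case; apply: (syn _ _ _ (fun i => x i 0) x) => //; exact: circulant_interconnection.
Qed.

(** For [A = C = 1], any fixed gain is defeated by a sufficiently weak coupling. *)
Lemma not_synchronizable_G_gt0_full (R : realType) :
  ~ (O_F R `<=` synchronizable (G_gt0 R)).
Proof.
pose P : mxpair R := @MxPair R 0 0 1%:M 1%:M.
move=> /(_ P)[|L syn]; first by rewrite /O_F /= row_full_unit unitmx1.
move: L syn; rewrite /P /= => L syn.
(* Chosen so that [2 * g * l <= 1], hence the mode [1 - 2 * g * l] does not decay. *)
pose l := L 0 0; pose g := (2 * (`|l| + 1))^-1.
have l1 : 0 < `|l| + 1 by rewrite ltr_wpDl.
have g0 : 0 < g by rewrite invr_gt0 mulr_gt0.
have c0 : 0 <= 1 - 2 * g * l.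
  rewrite subr_ge0 /g invfM mulrA mulfV // mul1r mulrC ler_pdivrMr // mul1r.
  by rewrite (le_trans (ler_norm l)) // lerDl.
pose X (t : R) : 'cV[R]_1 := const_mx (expR ((1 - 2 * g * l) * t)).
have [|||x sol] := @circulant2_not_synchronize R 0 0 1%:M 1%:M L g X 0.
- exact: ltW.
- move=> t k; have -> : (1%:M *m X t - (2 * g) *: (L *m 1%:M *m X t)) k 0 =
     (1 - 2 * g * l) * expR ((1 - 2 * g * l) * t).
    rewrite mul1mx mulmx1 !mxE big_ord1 !mxE !ord1 -/l; ring.
  rewrite /X; under eq_fun do rewrite mxE.
  by apply: is_derive_eq; rewrite /GRing.scale /=; ring.
- move=> t t0; rewrite mxE (le_trans _ (expR_ge1Dx _)) // lerDl mulr_ge0 //.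
case; apply: (syn _ _ _ (fun i => x i 0) x) => //; split.
  by apply: circulant_interconnection => //; exact: ltW.
exact: circulant_connected.
Qed.

(** With [A = C = 0] no information is exchanged; the two-node network of weight [delta] has the
    nonzero eigenvalue [- 2 delta] and so belongs to the family. *)
Lemma not_synchronizable_G_ge (R : realType) (delta : R) : 0 < delta ->
  ~ (P_all R `<=` synchronizable (G_ge delta)).
Proof.
move=> d0; pose P : mxpair R := @MxPair R 0 0 0 0.
move=> /(_ P I)[L syn].
have [|||x sol] := @circulant2_not_synchronize R 0 0 0 0 L delta (fun=> const_mx 1) 0.
- exact: ltW.
- move=> t k; rewrite mulmx0 !mul0mx scaler0 subr0 !mxE; exact: is_derive_cst.
- by move=> t _; rewrite mxE.
case; apply: (syn _ _ _ (fun i => x i 0) x) => //; split.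
- by apply: circulant_interconnection => //; exact: ltW.
- exact: circulant_connected.
- move=> l [lG l0 _]; rewrite (circulant2_eigenvalue lG l0) normrN.
  rewrite ger0_norm; last by rewrite mulr_ge0 // ltW.
  by rewrite ler_peMl ?ler1n // ltW.
Qed.

(** * The double integrator with measured position *)

Definition double_integrator (R : realType) : mxpair R :=
  @MxPair R 1 0 (delta_mx 0 0) (delta_mx 0 1).

Lemma double_integrator_A_J (R : realType) : A_J R (double_integrator R).
Proof.
apply: nilpotent_no_unstable => l /eigenvalue_vector[v Av v0].
apply/eqP; apply: contraT => l0; case/negP: v0; apply/eqP.
pose A : 'M[R]_2 := delta_mx 0 1.
have AA : cmx A *m cmx A = 0 by rewrite -map_mxM mul_delta_mx_0 // map_mx0.
rewrite -[dynmx _]/A in Av.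
have : l *: (l *: v) = 0 by rewrite -Av scalemxAr -Av mulmxA AA mul0mx.
by move/eqP; rewrite !scaler_eq0 (negPf l0) => /eqP.
Qed.

(** Only the zero state has zero output: time 0 gives the position, and time 1 then gives the
    velocity. *)
Lemma double_integrator_detectable (R : realType) : O_P R (double_integrator R).
Proof.
move=> x hx; suff -> : x = 0.
  by under eq_fun do rewrite mulmx0; exact: cvg_cst.
rewrite /= in x hx *; set A : 'M[R]_2 := delta_mx 0 1 in hx.
set C : 'M[R]_(1, 2) := delta_mx 0 0 in hx.
have AA : A *m A = 0 by rewrite mul_delta_mx_0.
have Cx (y : 'cV[R]_2) : C *m y = 0 -> y 0 0 = 0.
  by move=> /matrixP/(_ 0 0); rewrite -rowE !mxE.
have x0 : C *m x = 0 by rewrite -[x in LHS](expmx0_mul A) mulmxA hx.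
have x1 : C *m (A *m x) = 0.
  apply/matrixP => i j; have := @expmx_entry _ _ _ _ C A x i j 1.
  rewrite hx // [X in _ --> X]mxE [RHS]mxE => /cvg_lim <- //.
  (* As [A *m A = 0], the partial sums are constant from index 2 on. *)
  apply/esym/lim_near_cst => //; exists 2%N => // -[|[|N]] //= _.
  rewrite /pseries /series /= !big_nat_recl //= big1 => [|k _].
    rewrite addr0 /exp_entry !expr1 expr0 mulr1 mulr1 fact0 invr1 !mul1r.
    by rewrite mulmx1 x0 mxE add0r mulmxA.
  rewrite /exp_entry !exprS [A * (A * _)]mulrA -mulmxE AA mul0mx mulmx0 mul0mx.
  by rewrite mxE mulr0 mul0r.
apply/matrixP => i j; rewrite ord1 [RHS]mxE.
have y0 := Cx _ x0; have := Cx _ x1.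
rewrite mxE !big_ord_recl big_ord0 !mxE /= mul0r add0r mul1r addr0.
have -> : lift ord0 ord0 = 1 :> 'I_2 by apply: val_inj.
case: i => [[|[|[]]]] // ? e; [rewrite -[RHS]y0 | rewrite -[RHS]e];
  by congr (x _ _); apply: val_inj.
Qed.

Lemma double_integrator_mul (R : realType) (x : 'cV[R]_2) (k : 'I_2) :
  ((delta_mx 0 1 : 'M[R]_2) *m x) k 0 = (k == 0)%:R * x 1 0.
Proof.
rewrite mxE (bigD1 1) //= !mxE eqxx andbT big1 ?addr0 // => j /negPf j1.
by rewrite !mxE j1 andbF mul0r.
Qed.

Lemma double_integrator_output (R : realType) (L : 'M[R]_(2, 1)) (x : 'cV[R]_2)
    (k : 'I_2) :
  ((L *m (delta_mx 0 0 : 'M[R]_(1, 2))) *m x) k 0 = L k 0 * x 0 0.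
Proof. by rewrite -mulmxA -rowE mxE big_ord1 !mxE. Qed.

(* A gain with [L 1 0 <= 0] leaves a real unstable mode for the coupling -1;
   otherwise the coupling [- a - i b] below produces the mode [i r]. *)
Lemma not_synchronizable_G_gt0_detectable (R : realType) :
  ~ (A_J R `&` O_P R `<=` synchronizable (G_gt0 R)).
Proof.
move=> /(_ (double_integrator R))[|L syn].
  by split; [exact: double_integrator_A_J | exact: double_integrator_detectable].
rewrite /= in L syn.
pose l1 := L 0 0; pose l2 := L 1 0.
pose vec (u v : R) : 'cV[R]_2 := \col_k (if k == 0 then u else v).
have mxB (y z : 'cV[R]_2) k : (y - z) k 0 = y k 0 - z k 0 by rewrite !mxE.
have [l2_le0|l2_gt0] := leP l2 0.
  (* The larger root of [s^2 + l1 s + l2], the characteristic polynomial of [A - L C], with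
     eigenvector [(1, s + l1)]. *)
  pose s := (- l1 + Num.sqrt (l1 ^+ 2 - 4 * l2)) / 2.
  have D0 : 0 <= l1 ^+ 2 - 4 * l2 by have := sqr_ge0 l1; lra.
  have s0 : 0 <= s.
    rewrite divr_ge0 // addrC subr_ge0 (le_trans (ler_norm l1)) //.
    by rewrite -sqrtr_sqr ler_sqrt //; lra.
  have sE : s * (s + l1) = - l2.
    have := sqr_sqrtr D0; rewrite /s; set q := Num.sqrt _ => qE.
    by have -> : (- l1 + q) / 2 * ((- l1 + q) / 2 + l1) = (q ^+ 2 - l1 ^+ 2) / 4;
      [field | rewrite qE; field].
  have [|||x sol] := @circulant2_not_synchronize R 1 0 (delta_mx 0 1)
    (delta_mx 0 0) L (2^-1) (fun t => vec (expR (s * t)) ((s + l1) * expR (s * t))) 0.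
  - by rewrite invr_ge0.
  - move=> t k; rewrite mulfV // scale1r.
    rewrite mxB double_integrator_mul double_integrator_output !mxE /=.
    case: k => [[|[|[]]]] // ?.
    + rewrite (_ : L _ 0 = l1); last by congr (L _ _); apply: val_inj.
      under eq_fun do rewrite mxE /=.
      by apply: is_derive_eq; rewrite /GRing.scale /=; ring.
    + rewrite (_ : L _ 0 = l2); last by congr (L _ _); apply: val_inj.
      under eq_fun do rewrite mxE /=.
      apply: is_derive_eq; rewrite /GRing.scale /= -[l2]opprK -sE; ring.
  - move=> t t0; rewrite mxE /= (le_trans _ (expR_ge1Dx _)) // lerDl mulr_ge0 //.
  case; apply: (syn _ _ _ (fun i => x i 0) x) => //; split.
    by apply: circulant_interconnection => //; rewrite invr_ge0.
  by apply: circulant_connected => //; rewrite invr_gt0.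
(* The mode [i r] requires [- r^2 + mu (l2 + i r l1) = 0], that is, [mu = a + i b] with these
   values. The choice of [r] gives [r |l1| < l2], hence [|b| < a] and positive weights [g] and
   [h]. *)
pose r := l2 / (`|l1| + 1); pose D := l2 ^+ 2 + r ^+ 2 * l1 ^+ 2.
pose a := r ^+ 2 * l2 / D; pose b := - (r ^+ 3 * l1 / D).
have n1 : 0 < `|l1| + 1 by rewrite ltr_wpDl.
have r0 : 0 < r by rewrite divr_gt0.
have D0 : 0 < D by rewrite ltr_wpDr ?exprn_gt0 // mulr_ge0 ?sqr_ge0.
have Dn0 : D != 0 by rewrite gt_eqF.
have a0 : 0 < a by rewrite divr_gt0 // mulr_gt0 // exprn_gt0.
have rl : r * `|l1| < l2.
  by rewrite /r mulrAC ltr_pdivrMr // ltr_pM2l // ltrDl.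
have ba : `|b| < a.
  have -> : `|b| = r ^+ 3 * `|l1| / D.
    rewrite /b normrN 2!normrM (gtr0_norm (exprn_gt0 3 r0)).
    by rewrite (@gtr0_norm _ D^-1) ?invr_gt0.
  rewrite /a ltr_pM2r ?invr_gt0 // exprSr -mulrA ltr_pM2l // exprn_gt0 //.
have [ba1 ba2] : - a < b /\ b < a by move: ba; rewrite ltr_norml => /andP[].
(* [e1] and [e2] are the imaginary and real parts of [i r (i r + mu l1) = - mu l2]. *)
have e1 : r * l1 * a = - (l2 * b) by rewrite /a /b; field.
have DE : D - r ^+ 2 * l1 ^+ 2 = l2 ^+ 2 by rewrite /D addrK.
clearbody D; have e2 : r * (r + l1 * b) = l2 * a.
  transitivity (r ^+ 2 * (D - r ^+ 2 * l1 ^+ 2) / D); first by rewrite /b; field.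
  by rewrite DE /a; field.
(* [X] and [Y] are the real and imaginary parts of [exp (i r t)] times the eigenvector
   [(1, i r + mu l1)]. *)
pose X (t : R) := vec (cos (r * t))
  (l1 * a * cos (r * t) - (r + l1 * b) * sin (r * t)).
pose Y (t : R) := vec (sin (r * t))
  (l1 * a * sin (r * t) + (r + l1 * b) * cos (r * t)).
pose g := (a + b) / 2; pose h := (a - b) / 2.
have g0 : 0 < g by rewrite divr_gt0 //; lra.
have h0 : 0 < h by rewrite divr_gt0 //; lra.
have ghb : g - h = b by rewrite /g /h; field.
have gha : g + h = a by rewrite /g /h; field.
have [|||||x sol] := @circulant4_not_synchronize R 1 0 (delta_mx 0 1)
  (delta_mx 0 0) L g h X Y 0.
- exact: ltW.
- exact: ltW.
- move=> t k; rewrite mxE double_integrator_mul double_integrator_output ghb gha.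
  rewrite /X /Y !mxE /=; case: k => [[|[|[]]]] // ?.
  + rewrite (_ : L _ 0 = l1); last by congr (L _ _); apply: val_inj.
    under eq_fun do rewrite mxE /=.
    by apply: is_derive_eq; rewrite /GRing.scale /=; ring.
  + rewrite (_ : L _ 0 = l2); last by congr (L _ _); apply: val_inj.
    under eq_fun do rewrite mxE /=.
    apply: is_derive_eq; rewrite /GRing.scale /=.
    transitivity (- (r * l1 * a) * sin (r * t) - (r * (r + l1 * b)) * cos (r * t)).
      by ring.
    by rewrite e1 e2; ring.
- move=> t k; rewrite mxE double_integrator_mul double_integrator_output ghb gha.
  rewrite /X /Y !mxE /=; case: k => [[|[|[]]]] // ?.
  + rewrite (_ : L _ 0 = l1); last by congr (L _ _); apply: val_inj.
    under eq_fun do rewrite mxE /=.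
    by apply: is_derive_eq; rewrite /GRing.scale /=; ring.
  + rewrite (_ : L _ 0 = l2); last by congr (L _ _); apply: val_inj.
    under eq_fun do rewrite mxE /=.
    apply: is_derive_eq; rewrite /GRing.scale /=.
    transitivity ((r * l1 * a) * cos (r * t) - (r * (r + l1 * b)) * sin (r * t)).
      by ring.
    by rewrite e1 e2; ring.
- by move=> t; rewrite /X /Y !mxE /= cos2Dsin2.
case; apply: (syn _ _ _ (fun i => x i 0) x) => //; split.
  by apply: circulant_interconnection; exact: ltW.
by apply: circulant_connected => //; exact: ltW.
Qed.

(** * Synchronizability *)

(** With zero gain the nodes decouple. [array_modes_vanish] is used with [B = 0] and the identity in
    place of [G], so that the weight of a single node is admissible. *)
Lemma hurwitz_synchronizable (R : realType) : A_H R `<=` synchronizable (G_ge0 R).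
Proof.
move=> [n m C A] /= hA; exists 0 => p G hG x0 x _ sol.
exists (fun=> 0) => i; rewrite /=.
case: p => [|p] in G hG x0 x sol i *; first by case: i.
apply: mxnorm_cvg0 => a b; rewrite ord1.
have dx j (t : R) : 0 < t -> is_derive t (1 : R) (x j)
    (A *m x j t + 0 *m \sum_k (1%:M : 'M[R]_p.+1) j k *: x k t).
  by move=> t0; have [_ /(_ t t0)] := sol j; rewrite /= !mul0mx.
have h l : ceigenvalue (1%:M : 'M[R]_p.+1) l -> l != 0 ->
    hurwitzC (cmx A + l *: cmx (0 : 'M[R]_n.+1)).
  by rewrite map_mx0 scaler0 addr0 => _ _; exact: hurwitz_cmx.
have w1 k : exists v : 'rV[R]_p.+1, delta_mx 0 i = v *m (1%:M : 'M[R]_p.+1) ^+ k.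
  by exists (delta_mx 0 i); rewrite -[1%:M]/1 expr1n mulmx1.
have := array_modes_vanish h dx w1 a; apply: cvg_trans; apply: near_eq_cvg.
apply: nearW => t; rewrite subr0 (bigD1 i) //= mxE !eqxx mul1r big1 ?addr0 //.
by move=> j /negPf ji; rewrite mxE ji andbF mul0r.
Qed.

Theorem theorem1 (R : realType) (delta : R) (hdelta : 0 < delta) :
  (A_H R `<=` synchronizable (G_ge0 R)) /\
  (A_N R `&` O_P R `<=` synchronizable (G_gt0 R)) /\
  (A_J R `&` O_F R `<=` synchronizable (G_gt0 R)) /\
  (O_P R `<=` synchronizable (G_ge delta)) /\
  ~ (A_N R `&` O_F R `<=` synchronizable (G_ge0 R)) /\
  ~ (A_J R `&` O_P R `<=` synchronizable (G_gt0 R)) /\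
  ~ (O_F R `<=` synchronizable (G_gt0 R)) /\
  ~ (P_all R `<=` synchronizable (G_ge delta)).
Proof.
split; first exact: hurwitz_synchronizable.
split.
  move=> [n m C A] [/= hA hC].
  have [Q [pQ pL]] := neutrally_stable_lyap hA.
  have [L hL] := gain_passive (detectable_hautus hC) pQ pL.
  exists L => p G [hG cG] x0 x _; apply: (hurwitz_modes_synchronize hG cG).
  by move=> l lG l0; apply/hL/(interconnection_eigenvalue hG lG l0).
split.
  move=> [n m C A] [/= hA hC].
  have [L hL] := gain_row_full hC hA.
  exists L => p G [hG cG] x0 x _; apply: (hurwitz_modes_synchronize hG cG).
  by move=> l lG l0; apply/hL/(interconnection_eigenvalue hG lG l0).
split.
  move=> [n m C A] /= hC.
  have [L hL] := gain_detectable (detectable_hautus hC) hdelta.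
  exists L => p G [hG cG hd] x0 x _; apply: (hurwitz_modes_synchronize hG cG).
  move=> l lG l0; apply: hL; rewrite lerNr.
  have := lambda2_bound hd lG l0.
  by rewrite ltr0_norm // (interconnection_eigenvalue hG lG l0).
split; first exact: not_synchronizable_G_ge0.
split; first exact: not_synchronizable_G_gt0_detectable.
split; first exact: not_synchronizable_G_gt0_full.
exact: not_synchronizable_G_ge.
Qed.
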